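(* Let $G$ be a contact Carnot group and $p\in G$, $p\neq p_0$. The set $\Gamma(p)$ of geodesics from $p_0$ ending at $p$ can be decomposed into the disjoint union of two closed submanifolds $$\Gamma(p)=\Gamma_0(p)\cup\Gamma_\infty(p),$$ where $\Gamma_0(p)$ is finite and $\Gamma_\infty(p)$ is homeomorphic to a (disjoint, possibly empty or infinite) union of spheres. Moreover the energy function $J$ is constant on each connected component of $\Gamma(p)$.
   Context: A contact Carnot group $G$ is a connected, simply connected Lie group of dimension $2n+1$ whose Lie algebra of left-invariant vector fields splits as $\mathfrak g=\mathfrak g_1\oplus\mathfrak g_2$ with $\dim\mathfrak g_2=1$, $[\mathfrak g_1,\mathfrak g_1]=\mathfrak g_2$, $[\mathfrak g_1,\mathfrak g_2]=[\mathfrak g_2,\mathfrak g_2]=0$, with a scalar product on $\mathfrak g_1$ having orthonormal basis $f_1,\dots,f_{2n}$. Fix a generator $f_0$ of $\mathfrak g_2$; then $[f_i,f_j]=A_{ij}f_0$ for a skew-symmetric matrix $A$, which is required to be non-degenerate. $p_0$ denotes the identity of $G$. In exponential coordinates $p=(x,z)\in\mathbb{R}^{2n}\times\mathbb{R}$ means $p=\exp_G(\sum_i x_if_i+zf_0)$. Let $0<\alpha_1<\dots<\alpha_k$ be the distinct singular values of $A$; $x_j$ denotes the projection of $x$ on the invariant subspace of $\alpha_j$ (of dimension $2n_j$). A geodesic is a non-constant Lipschitz curve $\gamma:[0,1]\to G$, tangent a.e. to $\mathfrak g_1$, locally minimizing the energy $J(\gamma)=\frac12\int_0^1\|\dot\gamma\|^2dt$.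 Geodesics starting from $p_0$ are parametrized by their initial covector: with the Hamiltonian $H(\eta)=\frac12\sum_{i=1}^{2n}\langle\eta,f_i\rangle^2$ on $T^*G$, the geodesic with initial covector $\eta\in T^*_{p_0}G$ is $\gamma_\eta(t)=\pi(e^{t\vec H}(\eta))$, where $\vec H$ is the Hamiltonian vector field of $H$ and $\pi:T^*G\to G$ the projection; the exponential map is $\hat E(\eta)=\gamma_\eta(1)$, and for $p\ne p_0$ one sets $\Gamma(p)=\hat E^{-1}(p)\subset T^*_{p_0}G$ with the subspace topology. Write $\eta=(u,\lambda)=(u_1,\dots,u_k,\lambda)$, with $u$ the components $\langle\eta,f_i\rangle$ ($u_j$ the projection on the invariant subspace of $\alpha_j$) and $\lambda=\langle\eta,f_0\rangle$. The decomposition is: with $I_0=\{j\mid x_j=0\}$, $\Gamma_0(p)=\{(u,\lambda)\in\Gamma(p)\mid\sum_{j\in I_0}\|u_j\|^2=0\}$ and $\Gamma_\infty(p)=\Gamma(p)\setminus\Gamma_0(p)$. ''Submanifold'' allows components of different dimensions. *)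

(* Defs.v *)
From HB Require Import structures.
From mathcomp Require Import all_boot all_order all_algebra.
From mathcomp Require Import all_classical all_reals all_analysis.
From mathcomp Require Import ring.
Set Implicit Arguments.
Unset Strict Implicit.
Unset Printing Implicit Defensive.
Import Order.TTheory GRing.Theory Num.Theory.
Import numFieldNormedType.Exports.
Local Open Scope classical_set_scope.
Local Open Scope ring_scope.

(* The contact Carnot group with structure matrix A, in exponential
   coordinates: (x, z) stands for exp (\sum_i x_i f_i + z f_0), and by the
   Baker-Campbell-Hausdorff formula the group law is
     (x, z) (y, w) = (x + y, z + w + 1/2 \sum_(i, j) x_i A_ij y_j),
   with identity (0, 0).  The same coordinates are used on all (co)tangent
   spaces. *)
Notation coords R m := ('rV[R]_m * R^o)%type (only parsing).

Section ContactCarnot.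
Variables (R : realType) (m : nat).
Implicit Types (A : 'M[R]_m) (p q w eta : coords R m).

Definition carnot_mul A p q : coords R m :=
  (p.1 + q.1, p.2 + q.2 + 2^-1 * (p.1 *m A *m q.1^T) 0 0).

(* The left-invariant vector field with value w at the identity. *)
Definition left_field A w : coords R m -> coords R m :=
  fun q => 'D_w (carnot_mul A q) 0.

(* frame A is f_1, ..., f_m and frame0 A is f_0; at the identity they are the
   coordinate vectors, so a covector eta there has eta.1 0 i = <eta, f_i> and
   eta.2 = <eta, f_0>. *)
Definition frame A (i : 'I_m) := left_field A (delta_mx 0 i, 0).
Definition frame0 A := left_field A (0, 1).

Lemma derive_affine (V W : normedModType R) (f : V -> W) (a v : V) (d : W) :
  (forall h : R, f (h *: v + a) - f a = h *: d) -> 'D_v f a = d.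
Proof.
move=> fE; rewrite /derive; apply: cvg_lim => //.
apply: cvg_near_cst; near=> h.
rewrite /= [X in _ *: X]fE scalerA mulVf ?scale1r//.
by near: h; exact: nbhs_dnbhs_neq.
Unshelve. all: by end_near. Qed.

Lemma left_fieldE A w q : left_field A w q =
  (w.1, w.2 + 2^-1 * (q.1 *m A *m w.1^T) 0 0).
Proof.
apply: derive_affine => h; rewrite /carnot_mul /= !linear0 !addr0.
rewrite linearZ /= -scalemxAr mxE.
congr (_, _); first by rewrite /= addrAC subrr add0r.
by rewrite /= [X in _ - (_ + _ * X)]mxE /GRing.scale /=; ring.
Qed.

Lemma carnot_mulA A : associative (carnot_mul A).
Proof.
move=> p q r; congr (_, _); rewrite /= ?addrA//.
rewrite !mulmxDl linearD /= !mulmxDr !mxE; ring.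
Qed.

Lemma carnot_mul0l A : left_id 0 (carnot_mul A).
Proof. by move=> [x z]; rewrite /carnot_mul /= !mul0mx mxE mulr0 addr0 !add0r. Qed.

Lemma carnot_mulNl A : A^T = - A -> forall p, carnot_mul A (- p) p = 0.
Proof.
move=> skA p; have E : (p.1 *m A *m p.1^T) 0 0 = 0.
  have : (p.1 *m A *m p.1^T)^T = - (p.1 *m A *m p.1^T).
    by rewrite !trmx_mul trmxK skA mulNmx mulmxN mulmxA.
  move=> /matrixP/(_ 0 0); rewrite !mxE => /eqP.
  by rewrite -addr_eq0 -mulr2n mulrn_eq0 /= => /eqP.
by rewrite /carnot_mul /= !mulNmx mxE E oppr0 mulr0 addr0 !addNr.
Qed.

Definition lie_bracket (X Y : coords R m -> coords R m) q : coords R m :=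
  'D_(X q) Y q - 'D_(Y q) X q.

Lemma lie_bracket_left_field A v w : A^T = - A ->
  lie_bracket (left_field A v) (left_field A w) =
  left_field A (0, (v.1 *m A *m w.1^T) 0 0).
Proof.
move=> skA; apply/funext => q.
have D (x y : coords R m) :
    'D_x (left_field A y) q = (0, 2^-1 * (x.1 *m A *m y.1^T) 0 0).
  apply: derive_affine => h; rewrite !left_fieldE.
  congr (_, _); rewrite /= ?subrr ?scaler0//.
  rewrite !mulmxDl -!scalemxAl !mxE /GRing.scale /=; ring.
have E : (w.1 *m A *m v.1^T) 0 0 = - (v.1 *m A *m w.1^T) 0 0.
  have -> : w.1 *m A *m v.1^T = - (v.1 *m A *m w.1^T)^T.
    by rewrite !trmx_mul trmxK skA mulNmx mulmxN opprK mulmxA.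
  by rewrite !mxE.
rewrite /lie_bracket !D !left_fieldE /= E trmx0 mulmx0 [X in _ + _ * X]mxE.
by congr (_, _); rewrite /= ?subrr//; field.
Qed.

Lemma lie_bracket_frame A i j : A^T = - A ->
  lie_bracket (frame A i) (frame A j) = fun q => A i j *: frame0 A q.
Proof.
move=> skA; rewrite lie_bracket_left_field//; apply/funext => q.
rewrite /frame0 !left_fieldE /= trmx0 !mulmx0 -rowE trmx_delta -colE !mxE.
by congr (_, _); rewrite /= ?scaler0// /GRing.scale /=; ring.
Qed.

Lemma lie_bracket_frame0 A i : A^T = - A ->
  lie_bracket (frame A i) (frame0 A) = fun=> 0.
Proof.
move=> skA; rewrite lie_bracket_left_field//; apply/funext => q.
rewrite left_fieldE /= trmx0 !mulmx0 [X in X + _]mxE [X in _ + _ * X]mxE.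
by rewrite mulr0 addr0.
Qed.

Definition pairing eta w : R := \sum_i eta.1 0 i * w.1 0 i + eta.2 * w.2.

Definition hamiltonian A (s : coords R m * coords R m) : R^o :=
  2^-1 * \sum_i pairing s.2 (frame A i s.1) ^+ 2.

(* Canonical equations q' = dH/deta, eta' = - dH/dq on the cotangent bundle,
   whose points are written (q, eta). *)
Definition gradient (f : coords R m -> R^o) q : coords R m :=
  (\row_i 'D_(delta_mx 0 i, 0) f q, 'D_(0, 1) f q).

Definition hamiltonian_field A (s : coords R m * coords R m) :
    coords R m * coords R m :=
  (gradient (fun eta => hamiltonian A (s.1, eta)) s.2,
   - gradient (fun q => hamiltonian A (q, s.2)) s.1).

Definition integral_curve A (c : R -> coords R m * coords R m) : Prop :=
  forall t : R, is_derive t 1 c (hamiltonian_field A (c t)).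

(* The Hamiltonian field is complete, so exactly one curve satisfies the
   predicate and the default value is never used. *)
Definition extremal A eta : R -> coords R m * coords R m :=
  xget (fun=> (0, eta)) [set c | integral_curve A c /\ c 0 = (0, eta)].

Definition geodesic A eta : R -> coords R m := fun t => (extremal A eta t).1.

Definition exp_map A eta : coords R m := geodesic A eta 1.

Definition Gamma A p : set (coords R m) := exp_map A @^-1` [set p].

Definition sqnorm d (u : 'rV[R]_d) : R := \sum_i u 0 i ^+ 2.

(* By left_fieldE, frame A i = d/dx_i + (...) d/dz, so the components of a horizontal vector
   on the orthonormal frame are its x-coordinates. *)
Definition energy (g : R -> coords R m) : R :=
  2^-1 * \int[lebesgue_measure]_(t in `[0%R, 1%R]) sqnorm (derive1 g t).1.

Definition singular_value A (a : R) : Prop :=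
  0 <= a /\ eigenvalue (A^T *m A) (a ^+ 2).

(* Orthogonal projection of x on the A-invariant subspace attached to the
   singular value a. *)
Definition sv_proj A (a : R) (x : 'rV[R]_m) : 'rV[R]_m :=
  let V := eigenspace (A^T *m A) (a ^+ 2) in x *m proj_mx V (kermx V^T).

Definition Gamma0 A k (alpha : 'I_k -> R) p : set (coords R m) :=
  [set eta | Gamma A p eta /\
    \sum_(j < k | sv_proj A (alpha j) p.1 == 0)
      sqnorm (sv_proj A (alpha j) eta.1) = 0].

Definition Gammaoo A k (alpha : 'I_k -> R) p : set (coords R m) :=
  Gamma A p `\` Gamma0 A alpha p.

(* C^oo on the open set U: every iterated directional derivative is
   differentiable on U. *)
Definition iter_derive (vs : seq (coords R m)) (f : coords R m -> coords R m) :=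
  foldr (fun v g => 'D_v g) f vs.

Definition smooth_on (U : set (coords R m)) (f : coords R m -> coords R m) :=
  forall vs q, U q -> differentiable (iter_derive vs f) q.

(* Embedded submanifold, by slice charts; the dimension of the slice W may
   depend on the point. *)
Definition submanifold (S : set (coords R m)) : Prop :=
  forall q, S q ->
  exists (U V : set (coords R m)) (phi psi : coords R m -> coords R m)
         (W : {vspace coords R m}),
    [/\ [/\ open U, open V & U q],
        smooth_on U phi /\ smooth_on V psi,
        (forall x, U x -> V (phi x) /\ psi (phi x) = x),
        (forall y, V y -> U (psi y) /\ phi (psi y) = y) &
        phi @` (S `&` U) = V `&` [set y | y \in W]].

End ContactCarnot.

Definition homeomorphic (X Y : topologicalType) : Prop :=
  exists (f : X -> Y) (g : Y -> X),
    [/\ continuous f, continuous g, cancel f g & cancel g f].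

(* The unit sphere S^d of R^(d+1). *)
Definition sphere (R : realType) (d : nat) : set 'rV[R]_d.+1 :=
  [set v | sqnorm v = 1].
Arguments sphere : clear implicits.

Definition union_of_spheres (R : realType) (T : topologicalType) (S : set T) :=
  exists (I : choiceType) (d : I -> nat),
    homeomorphic (set_type S) {i : I & set_type (sphere R (d i))}.

(* Main.v *)
Require Import Defs.
From HB Require Import structures.
From mathcomp Require Import all_boot all_order all_algebra.
From mathcomp Require Import all_classical all_reals all_analysis.
From mathcomp Require Import ring lra complex.
Set Implicit Arguments.
Unset Strict Implicit.
Unset Printing Implicit Defensive.
Import Order.TTheory GRing.Theory Num.Theory.
Import numFieldNormedType.Exports.
Local Open Scope classical_set_scope.
Local Open Scope ring_scope.

(** Along an extremal the vertical covector l is constant and the momentum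
    solves u' = l u A, so u, x and z are explicit trigonometric functions on
    each eigenspace of A^T A: there J = A / alpha_j satisfies J^2 = -1 and, with
    s = l alpha_j,
      x_j = (sin s / s + (1 - cos s) / s J) u_j,
      z = \sum_j alpha_j |u_j|^2 (s - sin s) / (2 s^2).
    For fixed l the first equation determines u_j unless s is a nonzero multiple
    of 2 pi; in that case it forces x_j = 0 and leaves u_j free, and the second
    equation prescribes the norm of the free part of u.  Hence the part of
    Gamma over l is empty, a point, or a round sphere of squared radius rho l,
    and it lies over a locally finite set of l; Gamma_0 and Gamma_oo are the
    parts with rho l = 0 and rho l > 0.  Points with rho l = 0 and l <> 0 solve
    z = \sum_j c_j g (l alpha_j) with c_j = alpha_j |x_j|^2 / 4 and
    g s = (s - sin s) / (1 - cos s), which is strictly convex between its poles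
    and grows at least linearly, so there are finitely many of them. *)

(** * Spectral resolution of a skew-symmetric matrix *)

Section DotProduct.
Context {R : realType} {d : nat}.
Implicit Types (u v w : 'rV[R]_d) (c : R).

Definition dot u v : R := (u *m v^T) 0 0.

Lemma dotE u v : dot u v = \sum_i u 0 i * v 0 i.
Proof. by rewrite /dot mxE; apply: eq_bigr => i _; rewrite mxE. Qed.

Lemma dotC u v : dot u v = dot v u.
Proof. by rewrite !dotE; apply: eq_bigr => i _; rewrite mulrC. Qed.

Lemma dotDl u v w : dot (u + v) w = dot u w + dot v w.
Proof. by rewrite /dot mulmxDl mxE. Qed.

Lemma dotZl c u v : dot (c *: u) v = c * dot u v.
Proof. by rewrite /dot -scalemxAl mxE. Qed.

Lemma dot0l v : dot 0 v = 0.
Proof. by rewrite /dot mul0mx mxE. Qed.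

Lemma dotDr u v w : dot u (v + w) = dot u v + dot u w.
Proof. by rewrite ![dot u _]dotC dotDl. Qed.

Lemma dotZr c u v : dot u (c *: v) = c * dot u v.
Proof. by rewrite ![dot u _]dotC dotZl. Qed.

Lemma dot0r u : dot u 0 = 0.
Proof. by rewrite dotC dot0l. Qed.

Lemma dot_sumr (I : finType) u (f : I -> 'rV[R]_d) :
  dot u (\sum_i f i) = \sum_i dot u (f i).
Proof. by rewrite /dot linear_sum mulmx_sumr summxE. Qed.

Lemma sqnormE u : sqnorm u = dot u u.
Proof. by rewrite dotE; apply: eq_bigr => i _; rewrite expr2. Qed.

Lemma sqnorm_ge0 u : 0 <= sqnorm u.
Proof. by apply: sumr_ge0 => i _; exact: sqr_ge0. Qed.

Lemma sqnorm_eq0 u : (sqnorm u == 0) = (u == 0).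
Proof.
apply/eqP/eqP => [/eqP|->]; last by rewrite sqnormE dot0l.
rewrite psumr_eq0 => [/allP u0|i _]; last exact: sqr_ge0.
apply/rowP => i; rewrite mxE; apply/eqP; rewrite -sqrf_eq0.
exact/u0/mem_index_enum.
Qed.

Lemma sqnorm_gt0 u : (0 < sqnorm u) = (u != 0).
Proof. by rewrite lt_neqAle sqnorm_ge0 andbT eq_sym sqnorm_eq0. Qed.

Lemma sqnorm0 : sqnorm (0 : 'rV[R]_d) = 0.
Proof. by rewrite sqnormE dot0l. Qed.

Lemma sqnormZ c u : sqnorm (c *: u) = c ^+ 2 * sqnorm u.
Proof. by rewrite !sqnormE dotZl dotZr mulrA. Qed.

Lemma sqnormD u v : sqnorm (u + v) = sqnorm u + 2 * dot u v + sqnorm v.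
Proof. by rewrite !sqnormE dotDl !dotDr [dot v u]dotC; ring. Qed.

End DotProduct.

Lemma dot_mulmx (R : realType) (d e : nat) (M : 'M[R]_(d, e)) (u : 'rV[R]_d)
    (v : 'rV[R]_e) : dot (u *m M) v = dot u (v *m M^T).
Proof. by rewrite /dot trmx_mul trmxK mulmxA. Qed.

Lemma skew_dot0 (R : realType) (d : nat) (A : 'M[R]_d) (v : 'rV[R]_d) :
  A^T = - A -> dot (v *m A) v = 0.
Proof.
move=> skA; suff : dot (v *m A) v = - dot (v *m A) v by lra.
by rewrite {1}dot_mulmx skA mulmxN -scaleN1r dotZr mulN1r dotC.
Qed.

Lemma pairingE (R : realType) (m : nat) (p q : coords R m) :
  pairing p q = dot p.1 q.1 + p.2 * q.2.
Proof. by rewrite /pairing dotE. Qed.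

Lemma symmetric_diagonalizable (R : rcfType) (n : nat) (S : 'M[R]_n) :
  S^T = S -> diagonalizable S.
Proof.
case: n S => [|n] S symS.
  by rewrite (flatmx0 S); exact: diagonalizable0.
pose f := real_complex R; pose SC := map_mx f S.
have hermS : SC \is hermsymmx.
  apply/is_hermitianmxP; rewrite expr0 scale1r; apply/matrixP => i j.
  rewrite !mxE -[in LHS]symS mxE; apply/eqP.
  by rewrite eq_complex /= oppr0 !eqxx.
have /orthomx_spectralP SCE := hermitian_normalmx hermS.
have /mxOverP real_sp := hermitian_spectral_diag_real hermS.
pose d : 'rV[R]_n.+1 := \row_i complex.Re (spectral_diag SC 0 i).
have dE : spectral_diag SC = map_mx f d.
  apply/rowP => i; rewrite !mxE; have := real_sp 0 i.
  by case: (spectral_diag SC 0 i) => a b /complex_realP [c [-> ->]].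
have minE : map_poly f (mxminpoly S) = map_poly f (mxminpoly (diag_mx d)).
  rewrite -mxminpoly_map -/SC {1}SCE -conjVmx ?spectral_unit//.
  rewrite mxminpoly_uconj ?unitmx_inv ?spectral_unit//.
  by rewrite dE -map_diag_mx mxminpoly_map.
apply/diagonalizableP; move/map_poly_inj: minE => ->.
by rewrite mxminpoly_diag; eexists; [|exact: dvdpp]; rewrite undup_uniq.
Qed.

Section OrthogonalProjector.
Context {R : realType} {m : nat}.
Implicit Types (V W A : 'M[R]_m).

Definition ortho_projector V := proj_mx V (kermx V^T).

Lemma capmx_ortho V : (V :&: kermx V^T)%MS = 0.
Proof.
apply/eqP; rewrite -submx0; apply/row_subP => i; set u := row i _.
have: (u <= V :&: kermx V^T)%MS by exact: row_sub.
rewrite sub_capmx => /andP[/submxP[w uE] /sub_kermxP uV].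
suff: sqnorm u == 0 by rewrite sqnorm_eq0 => /eqP ->; exact: sub0mx.
by rewrite sqnormE {1}uE dot_mulmx uV dot0r.
Qed.

Lemma addsmx_ortho_full V : row_full (V + kermx V^T)%MS.
Proof.
have dx : mxdirect (V + kermx V^T) by apply/mxdirect_addsP; exact: capmx_ortho.
rewrite /row_full (mxdirectP dx) /= mxrank_ker mxrank_tr.
by rewrite subnKC ?rank_leq_row.
Qed.

Lemma ortho_projector_id V n (M : 'M[R]_(n, m)) :
  (M <= V)%MS -> M *m ortho_projector V = M.
Proof. by move=> MV; rewrite proj_mx_id// capmx_ortho. Qed.

Lemma ortho_projector_sub V : (ortho_projector V <= V)%MS.
Proof. by rewrite -[ortho_projector V]mul1mx proj_mx_sub. Qed.

Lemma ortho_projector_idem V :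
  ortho_projector V *m ortho_projector V = ortho_projector V.
Proof. exact/ortho_projector_id/ortho_projector_sub. Qed.

Lemma ortho_projector_sym V : (ortho_projector V)^T = ortho_projector V.
Proof.
set P := ortho_projector V.
suff PPT : P = P *m P^T by rewrite PPT trmx_mul trmxK -PPT.
have /submxP[w PE] := ortho_projector_sub V.
have: (1%:M - P) *m V^T = 0.
  apply/sub_kermxP; rewrite -[X in _ - X]mul1mx; apply: proj_mx_compl_sub.
  exact/submx_full/addsmx_ortho_full.
rewrite mulmxBl mul1mx => /(congr1 (mulmx^~ w^T)).
rewrite mulmxBl -mulmxA -trmx_mul -PE mul0mx => /eqP; rewrite subr_eq0.
by move=> /eqP/(congr1 trmx); rewrite trmxK trmx_mul trmxK.
Qed.

Lemma ortho_projectorM0 V W :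
  V *m W^T = 0 -> ortho_projector V *m ortho_projector W = 0.
Proof.
move=> VW; have /submxP[w PV] := ortho_projector_sub V.
have /submxP[w' PW] := ortho_projector_sub W.
rewrite -[ortho_projector W]ortho_projector_sym {1}PV {1}PW trmx_mul.
by rewrite -mulmxA (mulmxA V) VW mul0mx mulmx0.
Qed.

Lemma ortho_projector_comm V A : stablemx V A -> stablemx V A^T ->
  ortho_projector V *m A = A *m ortho_projector V.
Proof.
set P := ortho_projector V => VA VAT.
have PT : P^T = P by exact: ortho_projector_sym.
have PMP M : stablemx V M -> P *m M *m P = P *m M.
  move=> VM; apply/ortho_projector_id/(submx_trans _ VM).
  exact/submxMr/ortho_projector_sub.
have := PMP _ VAT => /(congr1 trmx).
by rewrite (trmx_mul _ P) (trmx_mul P) trmxK PT mulmxA PMP.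
Qed.

End OrthogonalProjector.

Section EigenProjector.
Context {R : realType} {m : nat} (S : 'M[R]_m) (S_sym : S^T = S).
Implicit Types a b : R.

Definition eigenprojector a := ortho_projector (eigenspace S a).

Lemma eigenprojector_mulmx a : eigenprojector a *m S = a *: eigenprojector a.
Proof. exact/eigenspaceP/ortho_projector_sub. Qed.

Lemma eigenprojectorM0 a b :
  a != b -> eigenprojector a *m eigenprojector b = 0.
Proof.
move=> ab; apply: ortho_projectorM0.
have ES c : eigenspace S c *m S = c *: eigenspace S c.
  exact/eigenspaceP/submx_refl.
have EST : S *m (eigenspace S b)^T = b *: (eigenspace S b)^T.
  by rewrite -{1}S_sym -trmx_mul ES linearZ.
have: (a - b) *: (eigenspace S a *m (eigenspace S b)^T) = 0.
  by rewrite scalerBl scalemxAl -ES scalemxAr -EST mulmxA subrr.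
by move=> /eqP; rewrite scaler_eq0 subr_eq0 (negbTE ab) => /eqP.
Qed.

Lemma eigenprojector_comm (A : 'M[R]_m) a :
  S *m A = A *m S -> eigenprojector a *m A = A *m eigenprojector a.
Proof.
move=> SA; apply: ortho_projector_comm; apply: comm_mx_stable_eigenspace => //.
by rewrite /comm_mx -[in LHS]S_sym -[in RHS]S_sym -!trmx_mul SA.
Qed.

Lemma sum_eigenprojector (I : finType) (r : I -> R) : injective r ->
  (forall a, eigenvalue S a -> exists j, r j = a) ->
  \sum_j eigenprojector (r j) = 1%:M.
Proof.
move=> r_inj r_all.
have [eigs _ eigsE] :
    exists2 eigs, uniq eigs & (\sum_(a <- eigs) eigenspace S a :=: 1%:M)%MS.
  by apply/diagonalizablePeigen; exact: symmetric_diagonalizable.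
have /sub_sumsmxP[w wE] : (1%:M <= \sum_j eigenspace S (r j))%MS.
  rewrite -eigsE; elim: eigs {eigsE} => [|a eigs IH].
    by rewrite big_nil sub0mx.
  rewrite big_cons addsmx_sub IH andbT.
  have [/r_all[j <-]|] := boolP (eigenvalue S a); first exact: (sumsmx_sup j).
  by rewrite negbK => /eqP ->; exact: sub0mx.
rewrite -[LHS]mul1mx wE mulmx_suml; apply: eq_bigr => j _.
have wj : (w j *m eigenspace S (r j) <= eigenspace S (r j))%MS.
  exact: submxMl.
rewrite -{1}(ortho_projector_id wj) -mulmxA mulmx_sumr (bigD1 j)//=.
rewrite big1 => [|i ij]; last by rewrite eigenprojectorM0// inj_eq 1?eq_sym.
by rewrite addr0 ortho_projector_idem ortho_projector_id.
Qed.

End EigenProjector.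

Record skew_resolution (R : realType) (m : nat) (I : finType) (A : 'M[R]_m)
    (alpha : I -> R) (P : I -> 'M[R]_m) : Prop := SkewResolution {
  resolution_skew : A^T = - A;
  resolution_gt0 : forall j, 0 < alpha j;
  resolution_sym : forall j, (P j)^T = P j;
  resolution_mul : forall i j, P i *m P j = if i == j then P i else 0;
  resolution_sum : \sum_j P j = 1%:M;
  resolution_comm : forall j, P j *m A = A *m P j;
  resolution_sqr : forall j, P j *m A *m A = - (alpha j ^+ 2) *: P j }.

Section SingularResolution.
Context {R : realType} {m : nat} (A : 'M[R]_m).

Definition sv_projector (a : R) := eigenprojector (A^T *m A) (a ^+ 2).

Lemma gram_sym : (A^T *m A)^T = A^T *m A.
Proof. by rewrite trmx_mul trmxK. Qed.

Lemma eigenvalue_gram_ge0 a : eigenvalue (A^T *m A) a -> 0 <= a.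
Proof.
move=> /eigenvalueP[v vA v0].
rewrite -(pmulr_lge0 (x := sqnorm v)) ?sqnorm_gt0// sqnormE -dotZl -vA mulmxA.
by rewrite dot_mulmx -sqnormE sqnorm_ge0.
Qed.

Lemma singular_value_gt0 a : A \in unitmx -> singular_value A a -> 0 < a.
Proof.
move=> A_unit [a0 /eigenvalueP[v vA v0]]; rewrite lt_neqAle a0 andbT.
apply: contra_neq v0 => a_eq0; move: vA.
rewrite -a_eq0 expr0n scale0r => /(congr1 (mulmx^~ (invmx (A^T *m A)))).
by rewrite mulmxK ?mul0mx// unitmx_mul unitmx_tr A_unit.
Qed.

Lemma singular_value_resolution (I : finType) (alpha : I -> R) :
  A^T = - A -> A \in unitmx -> injective alpha ->
  (forall a, singular_value A a <-> exists j, alpha j = a) ->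
  skew_resolution A alpha (sv_projector \o alpha).
Proof.
move=> skA A_unit alpha_inj alphaP.
have alpha_gt0 j : 0 < alpha j.
  by apply: singular_value_gt0 => //; apply/alphaP; exists j.
have sqr_inj : injective (fun j => alpha j ^+ 2).
  by move=> i j /eqP; rewrite eqrXn2 ?ltW// => /eqP/alpha_inj.
split=> //= [j|i j||j|j].
- exact: ortho_projector_sym.
- case: eqVneq => [->|ij]; first exact: ortho_projector_idem.
  by apply: eigenprojectorM0; [exact: gram_sym|rewrite (inj_eq sqr_inj)].
- apply: (sum_eigenprojector gram_sym sqr_inj) => a eig_a.
  have a0 := eigenvalue_gram_ge0 eig_a.
  have /alphaP[j ja] : singular_value A (Num.sqrt a).
    by split; rewrite ?sqrtr_ge0// sqr_sqrtr.
  by exists j; rewrite ja sqr_sqrtr.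
- apply: eigenprojector_comm; first exact: gram_sym.
  by rewrite skA !mulNmx mulmxN mulmxA.
- have := eigenprojector_mulmx (A^T *m A) (alpha j ^+ 2).
  by rewrite scaleNr /= -mulmxA => <-; rewrite {2}skA mulNmx mulmxN opprK.
Qed.

End SingularResolution.

(** * Directional derivatives *)

(* An alias of the type class is_derive, hidden from instance resolution. *)
Definition has_der (R : numFieldType) (V W : normedModType R) (x v : V)
  (f : V -> W) (df : W) : Prop := is_derive x v f df.

Section DerivativeRules.
Context {R : realType} {V : normedModType R} (x v : V).

Lemma has_der_eq (W : normedModType R) (f : V -> W) a b :
  has_der x v f a -> a = b -> has_der x v f b.
Proof. by move=> ? <-. Qed.

Lemma has_der_cst (W : normedModType R) (c : W) : has_der x v (fun=> c) 0.
Proof. exact: is_derive_cst. Qed.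

Lemma has_derD (W : normedModType R) (f g : V -> W) a b :
  has_der x v f a -> has_der x v g b ->
  has_der x v (fun y => f y + g y) (a + b).
Proof. by move=> fa gb; exact: (is_deriveD fa gb). Qed.

Lemma has_derN (W : normedModType R) (f : V -> W) a :
  has_der x v f a -> has_der x v (fun y => - f y) (- a).
Proof. by move=> fa; exact: (is_deriveN fa). Qed.

Lemma has_derZ (W : normedModType R) (k : R) (f : V -> W) a :
  has_der x v f a -> has_der x v (fun y => k *: f y) (k *: a).
Proof. by move=> fa; exact: (is_deriveZ k fa). Qed.

Lemma has_derM (f g : V -> R) a b : has_der x v f a -> has_der x v g b ->
  has_der x v (fun y => f y * g y) (f x * b + g x * a).
Proof. by move=> fa gb; exact: (is_deriveM fa gb). Qed.

Lemma has_derV (f : V -> R) a : f x != 0 -> has_der x v f a ->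
  has_der x v (fun y => (f y)^-1) (- f x ^- 2 * a).
Proof.
by move=> fx [df <-]; split; [exact: derivableV|rewrite deriveV].
Qed.

Lemma has_der_sum (W : normedModType R) (I : finType) (f : I -> V -> W)
    (a : I -> W) :
  (forall i, has_der x v (f i) (a i)) ->
  has_der x v (fun y => \sum_i f i y) (\sum_i a i).
Proof.
move=> fa; rewrite (_ : (fun y => _) = \sum_i f i).
  elim/big_ind2: _ => [|f1 a1 f2 a2|i _]; last exact: fa.
    exact: has_der_cst.
  exact: has_derD.
by apply/funext => y; rewrite fct_sumE.
Qed.

Lemma has_der_linear (W W' : normedModType R) (L : W -> W') (f : V -> W) a :
  linear L -> continuous L -> has_der x v f a ->
  has_der x v (fun y => L (f y)) (L a).
Proof.
move=> linL cL [/cvg_ex[l fl] <-].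
have LfE : (fun h : R => h^-1 *: (L (f (h *: v + x)) - L (f x))) =
    L \o (fun h : R => h^-1 *: (f (h *: v + x) - f x)).
  pose linear_L : {linear W -> W'} :=
    HB.pack L (GRing.isLinear.Build R W W' *:%R L linL).
  apply/funext => h; rewrite -[RHS]/(linear_L _) linearZ.
  by rewrite [in RHS](linearB linear_L).
have Lfl : (fun h : R => h^-1 *: (L (f (h *: v + x)) - L (f x))) @ 0^' --> L l.
  by rewrite LfE; apply: continuous_cvg; [exact: cL|exact: fl].
have -> : 'D_v f x = l by apply: cvg_lim => //; exact: fl.
split; first by apply/cvg_ex; exists (L l); exact: Lfl.
by apply: cvg_lim => //; exact: Lfl.
Qed.

Lemma has_derZl (W : normedModType R) (f : V -> R) (w : W) a :
  has_der x v f a -> has_der x v (fun y => f y *: w) (a *: w).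
Proof.
apply: (@has_der_linear R^o W (fun r => r *: w)); last exact: scalel_continuous.
by move=> r s t; rewrite scalerDl scalerA.
Qed.

Lemma has_der_fst (W W' : normedModType R) (f : V -> W * W') a :
  has_der x v f a -> has_der x v (fun y => (f y).1) a.1.
Proof. by apply: has_der_linear => // y; exact: cvg_fst. Qed.

Lemma has_der_snd (W W' : normedModType R) (f : V -> W * W') a :
  has_der x v f a -> has_der x v (fun y => (f y).2) a.2.
Proof. by apply: has_der_linear => // y; exact: cvg_snd. Qed.

Lemma has_der_pair (W W' : normedModType R) (f : V -> W) (g : V -> W') a b :
  has_der x v f a -> has_der x v g b ->
  has_der x v (fun y => (f y, g y)) (a, b).
Proof.
move=> [/cvg_ex[l fl] <-] [/cvg_ex[l' gl] <-].
have -> : 'D_v f x = l by apply: cvg_lim => //; exact: fl.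
have -> : 'D_v g x = l' by apply: cvg_lim => //; exact: gl.
have fg := cvg_pair fl gl.
split; first by apply/cvg_ex; exists (l, l'); exact: fg.
by apply: cvg_lim => //; exact: fg.
Qed.

Lemma has_der_affine (W : normedModType R) (f : V -> W) (d : W) :
  (forall h : R, f (h *: v + x) = f x + h *: d) -> has_der x v f d.
Proof.
move=> fE; have dE : 'D_v f x = d.
  by apply: derive_affine => h; rewrite fE addrAC subrr add0r.
split=> //; apply/cvg_ex; exists d; apply: cvg_near_cst; near=> h.
rewrite /= fE addrAC subrr add0r scalerA mulVf ?scale1r//.
by near: h; exact: nbhs_dnbhs_neq.
Unshelve. all: by end_near. Qed.

Lemma has_der_rowP n (f : V -> 'rV[R]_n) (a : 'rV[R]_n) :
  has_der x v f a <-> forall i, has_der x v (fun y => f y 0 i) (a 0 i).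
Proof.
split=> [fa i|fi].
  apply: (has_der_linear (L := fun w : 'rV[R]_n => w 0 i)) fa.
    by move=> r w w'; rewrite !mxE.
  exact: coord_continuous.
have df : derivable f x v.
  by apply/derivable_mxP => i j; rewrite ord1; have [] := fi j.
split=> //; rewrite derive_mx//; apply/rowP => i; rewrite mxE.
by have [_ <-] := fi i.
Qed.

Lemma has_der_mulmx n p (M : 'M[R]_(n, p)) (f : V -> 'rV[R]_n) a :
  has_der x v f a -> has_der x v (fun y => f y *m M) (a *m M).
Proof.
move=> /has_der_rowP fi; apply/has_der_rowP => j.
have -> : (fun y => (f y *m M) 0 j) = (fun y => \sum_i f y 0 i * M i j).
  by apply/funext => y; rewrite mxE.
rewrite mxE; apply: has_der_sum => i; apply: has_der_eq.
  by apply: has_derM; [exact: fi|exact: has_der_cst].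
by rewrite mulr0 add0r mulrC.
Qed.

Lemma has_der_sqnorm n (f : V -> 'rV[R]_n) a :
  has_der x v f a -> has_der x v (fun y => sqnorm (f y)) (2 * dot (f x) a).
Proof.
move=> /has_der_rowP fi; apply: has_der_eq.
  by apply: has_der_sum => i; apply: has_derM; exact: fi.
by rewrite dotE mulr_sumr; apply: eq_bigr => i _; rewrite mulr_natl mulr2n.
Qed.

End DerivativeRules.

Section RealDerivativeRules.
Context {R : realType}.
Implicit Types (f g : R -> R) (x a b : R).

Lemma has_der_id x : has_der x 1 (fun t : R => t) 1.
Proof. exact: is_derive_id. Qed.

Lemma has_der_comp f g x a b : has_der (g x) 1 f a -> has_der x 1 g b ->
  has_der x 1 (fun t => f (g t)) (a * b).
Proof. by move=> fa gb; exact: (is_derive1_comp fa gb). Qed.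

Lemma has_der_sin f x a : has_der x 1 f a ->
  has_der x 1 (fun t => sin (f t)) (cos (f x) * a).
Proof. by apply: has_der_comp; exact: is_derive_sin. Qed.

Lemma has_der_cos f x a : has_der x 1 f a ->
  has_der x 1 (fun t => cos (f t)) (- sin (f x) * a).
Proof. by apply: has_der_comp; exact: is_derive_cos. Qed.

Lemma antiderivative_unique f g df : (forall t : R, has_der t 1 f (df t)) ->
  (forall t : R, has_der t 1 g (df t)) -> f 0 = g 0 -> f = g.
Proof.
move=> fdf gdf fg0; apply/funext => t; apply/eqP; rewrite -subr_eq0; apply/eqP.
transitivity (f 0 - g 0); last by rewrite fg0 subrr.
apply: (@is_derive_0_is_cst R (fun t => f t - g t)) => r.
by rewrite -(subrr (df r)); exact: has_derD (fdf r) (has_derN (gdf r)).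
Qed.

Lemma row_antiderivative_unique n (f g df : R -> 'rV[R]_n) :
  (forall t : R, has_der t 1 f (df t)) ->
  (forall t : R, has_der t 1 g (df t)) ->
  f 0 = g 0 -> f = g.
Proof.
move=> fdf gdf fg0; apply/funext => t; apply/rowP => i.
suff : (fun t => f t 0 i) = (fun t => g t 0 i) by move=> /(congr1 (@^~ t)).
apply: (antiderivative_unique (df := fun t => df t 0 i)) => [r|r|]; last by rewrite fg0.
  by have /has_der_rowP := fdf r.
by have /has_der_rowP := gdf r.
Qed.

Lemma has_der_continuous_itv f df (a b : R) :
  (forall x, a <= x <= b -> has_der x 1 f (df x)) ->
  {within `[a, b], continuous f}.
Proof.
move=> fdf; apply: derivable_within_continuous => x.
by rewrite in_itv /= => /fdf[].
Qed.

Lemma has_der_rolle f df (a b : R) : a < b ->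
  (forall x, a <= x <= b -> has_der x 1 f (df x)) -> f a = f b ->
  exists2 x, a < x < b & df x = 0.
Proof.
move=> ab fdf fab; have inI x : x \in `]a, b[%R -> a <= x <= b.
  by rewrite in_itv /= => /andP[/ltW -> /ltW].
have [x /inI/fdf[]//||x xab fx0] := Rolle ab _ _ fab.
  exact: has_der_continuous_itv fdf.
exists x; first by move: xab; rewrite in_itv.
by have [_ <-] := fdf _ (inI _ xab); exact: derive_val.
Qed.

Lemma has_der_rolle2 f df ddf (a b c : R) : a < b -> b < c ->
  (forall x, a <= x <= c -> has_der x 1 f (df x)) ->
  (forall x, a <= x <= c -> has_der x 1 df (ddf x)) ->
  f a = f b -> f b = f c -> exists2 x, a < x < c & ddf x = 0.
Proof.
move=> ab bc fdf dfddf fab fbc.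
have fdf_ab x : a <= x <= b -> has_der x 1 f (df x).
  by move=> /andP[ax xb]; apply: fdf; rewrite ax (le_trans xb (ltW bc)).
have fdf_bc x : b <= x <= c -> has_der x 1 f (df x).
  by move=> /andP[bx xc]; apply: fdf; rewrite xc (le_trans (ltW ab) bx).
have [x /andP[ax xb] dfx] := has_der_rolle ab fdf_ab fab.
have [y /andP[bY yc] dfy] := has_der_rolle bc fdf_bc fbc.
have dfddf_xy t : x <= t <= y -> has_der t 1 df (ddf t).
  move=> /andP[xt ty]; apply: dfddf.
  by rewrite (le_trans (ltW ax) xt) (le_trans ty (ltW yc)).
have [w /andP[xw wy] ddfw] :=
  has_der_rolle (lt_trans xb bY) dfddf_xy (etrans dfx (esym dfy)).
by exists w; rewrite // (lt_trans ax xw) (lt_trans wy yc).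
Qed.

Lemma has_der_gt0_lt f df (a b : R) : a < b ->
  (forall x, a <= x <= b -> has_der x 1 f (df x)) ->
  (forall x, a < x < b -> 0 < df x) -> f a < f b.
Proof.
move=> ab fdf df_gt0.
have [x||x] := @MVT _ f df _ _ ab.
- by rewrite in_itv /= => /andP[/ltW ax /ltW xb]; apply: fdf; rewrite ax.
- exact: has_der_continuous_itv fdf.
rewrite in_itv /= => /df_gt0 dfx fab.
by rewrite -subr_gt0 fab mulr_gt0 ?subr_gt0.
Qed.

End RealDerivativeRules.

Ltac derive_rules := repeat first
  [ exact: has_der_id | exact: has_der_cst
  | apply: has_derD | apply: has_derN | apply: has_derM | apply: has_derV
  | apply: has_der_sin | apply: has_der_cos ].

(** * Resonances and the convexity argument *)

Section CosEqualOne.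
Context {R : realType}.
Implicit Types s t x : R.

Lemma pi2_gt0 : 0 < pi *+ 2 :> R.
Proof. by rewrite mulrn_wgt0// pi_gt0. Qed.

Lemma one_sub_cos t : 1 - cos t = 2 * sin (t / 2) ^+ 2.
Proof.
rewrite {1}(splitr t) -mulr2n cos_mulr2n -mulr_natl.
by have := cos2Dsin2 (t / 2); lra.
Qed.

Lemma one_sub_cos_gt0 x : (0 < 1 - cos x) = (cos x != 1).
Proof. by rewrite subr_gt0 lt_neqAle cos_le1 andbT. Qed.

Lemma cos_eq1_sin0 x : cos x = 1 -> sin x = 0.
Proof. by move=> cx; apply: cos1sin0; rewrite cx normr1. Qed.

Lemma cos_neq1_period t : 0 < t < pi *+ 2 -> cos t != 1.
Proof.
rewrite mulr2n => /andP[t0 t2]; rewrite -one_sub_cos_gt0 one_sub_cos.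
rewrite mulr_gt0// exprn_gt0// sin_gt0_pi//.
by apply/andP; split; lra.
Qed.

Lemma truncn_period_itv x : 0 <= x ->
  pi *+ 2 *+ Num.truncn (x / (pi *+ 2)) <= x
    < pi *+ 2 *+ (Num.truncn (x / (pi *+ 2))).+1.
Proof.
move=> x0; have : 0 <= x / (pi *+ 2) by rewrite divr_ge0// ltW// pi2_gt0.
by move=> /truncn_itv; rewrite ler_pdivlMr ?ltr_pdivrMr ?pi2_gt0// !mulr_natl.
Qed.

Lemma cos_eq1_truncn x : 0 <= x -> cos x = 1 ->
  x = pi *+ 2 *+ Num.truncn (x / (pi *+ 2)).
Proof.
move=> /truncn_period_itv; set n := Num.truncn _ => /andP[nx xn] cx.
apply/eqP; rewrite eq_le nx andbT leNgt; apply/negP => lt_nx.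
have /negP[] : cos (x - pi *+ 2 *+ n) != 1.
  apply: cos_neq1_period; rewrite subr_gt0 lt_nx /=.
  by move: xn; rewrite mulrSr; lra.
by rewrite -(periodicn (@cosD2pi R) n) subrK cx.
Qed.

Lemma cos_neq1_between s t x : 0 < s -> s <= x <= t ->
  Num.truncn (s / (pi *+ 2)) = Num.truncn (t / (pi *+ 2)) ->
  cos s != 1 -> cos x != 1.
Proof.
move=> s0 /andP[sx xt] st; apply: contra_neq => cx.
suff -> : s = x by [].
have /andP[ns _] := truncn_period_itv (ltW s0).
apply/eqP; rewrite eq_le sx /=; apply: le_trans ns.
rewrite (cos_eq1_truncn (le_trans (ltW s0) sx) cx) ler_wpMn2l ?ltW ?pi2_gt0//.
by rewrite st le_truncn// ler_pM2r// invr_gt0 pi2_gt0.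
Qed.

End CosEqualOne.

Lemma finite_set_closed (R : numFieldType) (W : normedModType R) (S : set W) :
  finite_set S -> closed S.
Proof.
have acc : accessible_space W by exact/hausdorff_accessible/norm_hausdorff.
exact: (accessible_finite_set_closed.1 acc).
Qed.

Section FiniteRealSets.
Context {R : realType}.
Implicit Types S L F : set R.

Lemma finite_set_no_chain3 S :
  (forall a b c, S a -> S b -> S c -> a < b -> b < c -> False) -> finite_set S.
Proof.
move=> chain3; apply: contrapT => /(infinite_set_fset 3)[B BS].
have sorted_B : sorted <%R (sort <=%R (finmap.enum_fset B)).
  by rewrite sort_lt_sorted finmap.fset_uniq.
have memB x : x \in sort <=%R (finmap.enum_fset B) -> S x.
  by rewrite mem_sort => xB; exact: BS.
rewrite -(size_sort <=%R); case: sort sorted_B memB => [|a [|b [|c s]]]//=.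
move=> /and3P[ab bc _] memB _; apply: (chain3 a b c) => //.
- by apply: memB; rewrite !inE eqxx.
- by apply: memB; rewrite !inE eqxx orbT.
- by apply: memB; rewrite !inE eqxx !orbT.
Qed.

Lemma finite_preimage_normr F :
  finite_set F -> finite_set [set x : R | F `|x|].
Proof.
move=> finF; apply: (@sub_finite_set _ _ (F `|` -%R @` F)).
  move=> x /=; case: (leP 0 x) => x0.
    by rewrite ger0_norm//; left.
  by rewrite ltr0_norm//; right; exists (- x); rewrite ?opprK.
by rewrite finite_setU; split=> //; exact: finite_image.
Qed.

Definition locally_finite L := forall M, finite_set (L `&` [set l | `|l| <= M]).

Lemma sub_locally_finite L L' :
  L `<=` L' -> locally_finite L' -> locally_finite L.
Proof.
by move=> LL' finL' M; apply: sub_finite_set (finL' M); exact: setSI.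
Qed.

Lemma locally_finiteU L L' :
  locally_finite L -> locally_finite L' -> locally_finite (L `|` L').
Proof. by move=> finL finL' M; rewrite setIUl finite_setU. Qed.

Lemma finite_locally_finite L : finite_set L -> locally_finite L.
Proof. by move=> finL M; apply: sub_finite_set finL; exact: subIsetl. Qed.

Lemma locally_finite_isolated L l0 : locally_finite L ->
  exists2 e : R, 0 < e & forall l, `|l - l0| < e -> L l -> l = l0.
Proof.
move=> finL; set F := (L `&` [set l | `|l| <= `|l0| + 1]) `\ l0.
have closedF : closed (F : set R^o).
  by apply: finite_set_closed; exact/finite_setD/(finL _).
have : nbhs (l0 : R^o) (~` F).
  by apply: open_nbhs_nbhs; split; [exact: closed_openC|case=> _ /(_ erefl)].
rewrite -nbhs_ballE => -[e /= e0 ballF].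
exists (Num.min e 1); first by rewrite lt_min e0 ltr01.
move=> l; rewrite lt_min => /andP[le l1] Ll; apply: contrapT => ll0.
apply: (ballF l); first by rewrite /ball /= distrC.
split=> //; split=> //=.
by rewrite -[l in `|l|](subrK l0) (le_trans (ler_normD _ _))// addrC lerD2l ltW.
Qed.

Lemma connected_locally_finite (E L : set R) a b : locally_finite L ->
  connected (E : set R^o) -> E `<=` L -> E a -> E b -> a = b.
Proof.
move=> finL /connected_intervalP itvE EL.
wlog ab : a b / a <= b => [H Ea Eb|Ea Eb].
  by case: (leP a b) => [|/ltW] /H ->.
move: ab; rewrite le_eqVlt => /predU1P[//|ab].
have [e e0 iso] := locally_finite_isolated a finL.
pose y := a + Num.min e (b - a) / 2.
have m0 : 0 < Num.min e (b - a) by rewrite lt_min e0 subr_gt0.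
have me : Num.min e (b - a) <= e by rewrite ge_min lexx.
have mb : Num.min e (b - a) <= b - a by rewrite ge_min lexx orbT.
have Ey : E y by apply: (itvE a b) => //; apply/andP; split; rewrite /y; lra.
have : y = a.
  by apply: iso; [rewrite /y addrAC subrr add0r gtr0_norm; lra|exact: EL].
by rewrite /y; lra.
Qed.

Lemma locally_finite_resonances (I : finType) (alpha : I -> R) :
  (forall j, 0 < alpha j) ->
  locally_finite [set l | exists j, cos (l * alpha j) = 1].
Proof.
move=> alpha0 M; pose N j := Num.truncn (M * alpha j / (pi *+ 2)).
pose F := \bigcup_(j in [set: I])
  (fun n : nat => pi *+ 2 *+ n / alpha j) @` `I_(N j).+1.
apply: (@sub_finite_set _ _ [set l | F `|l|]); last first.
  apply: finite_preimage_normr; apply: bigcup_finite => [|j _].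
    exact: finite_finset.
  exact/finite_image/finite_II.
move=> l [[j cj] lM]; exists j => //.
have cj' : cos (`|l| * alpha j) = 1.
  by rewrite -[alpha j]gtr0_norm// -normrM cos_norm.
have lj0 : 0 <= `|l| * alpha j by rewrite mulr_ge0// ltW.
exists (Num.truncn (`|l| * alpha j / (pi *+ 2))) => /=.
  by rewrite ltnS le_truncn// ler_pM2r ?invr_gt0 ?pi2_gt0// ler_pM2r.
by rewrite -cos_eq1_truncn// mulfK// gt_eqF.
Qed.

End FiniteRealSets.

Section Slope.
Context {R : realType}.
Implicit Types s : R.

(* Cusa's inequality: the derivative of s - 3 sin s / (2 + cos s) is
   ((1 - cos s) / (2 + cos s))^2. *)
Lemma cusa_huygens s : 0 < s -> 0 < 2 * s + s * cos s - 3 * sin s.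
Proof.
move=> s0; have [s3|s3] := ltP 3 s.
  have := sin_le1 s; have := cos_geN1 s => c1 s1.
  have : 0 <= s * (cos s + 1) by rewrite mulr_ge0//; lra.
  by lra.
have c2 (x : R) : 0 < 2 + cos x by have := cos_geN1 x; lra.
pose f (x : R) := x - 3 * (sin x / (2 + cos x)).
pose df (x : R) := ((1 - cos x) / (2 + cos x)) ^+ 2.
have fdf (x : R) : has_der x 1 f (df x).
  apply: has_der_eq; first by rewrite /f; derive_rules; rewrite gt_eqF.
  by rewrite /df; field: (sin2cos2 x); rewrite gt_eqF.
have : f 0 < f s.
  apply: (has_der_gt0_lt s0 (fun x _ => fdf x)) => x /andP[x0 xs].
  rewrite /df exprn_gt0// divr_gt0// one_sub_cos_gt0 cos_neq1_period// x0 /=.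
  by rewrite mulr2n; have := pi_ge2 R; lra.
rewrite /f sin0 mul0r mulr0 subr0 subr_gt0 mulrA ltr_pdivrMr//.
by rewrite mulrDr; lra.
Qed.

Lemma sin_lt_id s : 0 < s -> sin s < s.
Proof.
move=> s0; have := cusa_huygens s0.
have : s * cos s <= s by rewrite ger_pMr// cos_le1.
by lra.
Qed.

Definition slope s := (s - sin s) / (1 - cos s).
Definition dslope s :=
  (2 - 2 * cos s - s * sin s) / ((1 - cos s) * (1 - cos s)).
Definition d2slope s := (2 * s + s * cos s - 3 * sin s) / (1 - cos s) ^+ 2.

Lemma slopeN s : slope (- s) = - slope s.
Proof. by rewrite /slope sinN cosN -opprD mulNr. Qed.

Lemma has_der_slope s : cos s != 1 -> has_der s 1 slope (dslope s).
Proof.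
rewrite -one_sub_cos_gt0 => /gt_eqF/negbT cs.
apply: has_der_eq; first by rewrite /slope; derive_rules.
by rewrite /dslope; field: (sin2cos2 s).
Qed.

Lemma has_der_dslope s : cos s != 1 -> has_der s 1 dslope (d2slope s).
Proof.
rewrite -one_sub_cos_gt0 => /gt_eqF/negbT cs.
apply: has_der_eq.
  by rewrite /dslope; derive_rules; rewrite mulf_neq0.
by rewrite /d2slope; field: (sin2cos2 s).
Qed.

Lemma d2slope_gt0 s : 0 < s -> cos s != 1 -> 0 < d2slope s.
Proof.
rewrite -one_sub_cos_gt0 => s0 cs.
by rewrite divr_gt0 ?cusa_huygens// exprn_gt0.
Qed.

Lemma slope_ge0 s : 0 < s -> 0 <= slope s.
Proof. by move=> s0; rewrite divr_ge0 ?subr_ge0 ?cos_le1// ltW// sin_lt_id. Qed.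

Lemma slope_ge s : 0 < s -> cos s != 1 -> (s - 1) / 2 <= slope s.
Proof.
rewrite -one_sub_cos_gt0 => s0 c1; rewrite ler_pdivlMr//.
have := sin_le1 s; have := cos_geN1 s; have := sin_lt_id s0 => ss c s1.
have [s11|s11] := leP s 1.
  have : (s - 1) / 2 * (1 - cos s) <= 0 by rewrite mulr_le0_ge0//; lra.
  by lra.
have : (s - 1) * (1 - cos s) <= (s - 1) * 2 by rewrite ler_pM2l//; lra.
by lra.
Qed.

End Slope.

Section DilationSum.
Context {R : realType} {I : finType} (alpha : I -> R).
Context (alpha_gt0 : forall j, 0 < alpha j).
Implicit Types (c : I -> R) (h : R -> R) (l z : R).

Definition dilation_sum c h l := \sum_j c j * h (l * alpha j).

Definition admissible c l := forall j, c j != 0 -> cos (l * alpha j) != 1.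

Lemma has_der_dilation_sum c h dh l :
  (forall j, c j != 0 -> has_der (l * alpha j) 1 h (dh (l * alpha j))) ->
  has_der l 1 (dilation_sum c h) (dilation_sum (fun j => c j * alpha j) dh l).
Proof.
move=> hdh; apply: has_der_sum => j; have [->|cj] := eqVneq (c j) 0.
  rewrite !mul0r (_ : (fun l => _) = fun=> 0); first exact: has_der_cst.
  by apply/funext => t; rewrite mul0r.
apply: has_der_eq.
  apply: has_derM; first exact: has_der_cst.
  apply: (@has_der_comp _ h (fun t => t * alpha j)); last by derive_rules.
  exact: hdh.
by rewrite /=; ring.
Qed.

Context (c : I -> R) (c_ge0 : forall j, 0 <= c j) (c_neq0 : exists j, c j != 0).

Lemma dilation_sum_d2slope_gt0 l : 0 < l -> admissible c l ->
  0 < dilation_sum (fun j => c j * alpha j * alpha j) d2slope l.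
Proof.
move=> l0 adm; have [i ci] := c_neq0.
have term_gt0 j :
    c j != 0 -> 0 < c j * alpha j * alpha j * d2slope (l * alpha j).
  move=> cj; have cj0 : 0 < c j by rewrite lt_neqAle eq_sym cj c_ge0.
  by apply: mulr_gt0; [rewrite !mulr_gt0|rewrite d2slope_gt0 ?mulr_gt0 ?adm].
rewrite /dilation_sum (bigD1 i)//= ltr_wpDr ?term_gt0// sumr_ge0// => j _.
by have [->|/term_gt0/ltW//] := eqVneq (c j) 0; rewrite !mul0r.
Qed.

Lemma dilation_sum_slope_convex (l1 l2 l3 : R) : 0 < l1 -> l1 < l2 -> l2 < l3 ->
  (forall l, l1 <= l <= l3 -> admissible c l) ->
  dilation_sum c slope l1 = dilation_sum c slope l2 ->
  dilation_sum c slope l2 = dilation_sum c slope l3 -> False.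
Proof.
move=> l10 l12 l23 adm E12 E23.
pose F1 := dilation_sum (fun j => c j * alpha j) dslope.
pose F2 := dilation_sum (fun j => c j * alpha j * alpha j) d2slope.
have F1P l : l1 <= l <= l3 -> has_der l 1 (dilation_sum c slope) (F1 l).
  by move=> /adm al; apply: has_der_dilation_sum => j /al; exact: has_der_slope.
have F2P l : l1 <= l <= l3 -> has_der l 1 F1 (F2 l).
  move=> /adm al; apply: has_der_dilation_sum => j.
  by rewrite mulf_eq0 negb_or => /andP[/al + _]; exact: has_der_dslope.
have [l /andP[ll1 ll3] F2l] := has_der_rolle2 l12 l23 F1P F2P E12 E23.
have : 0 < F2 l; last by rewrite F2l ltxx.
apply: dilation_sum_d2slope_gt0; first exact: lt_trans ll1.
by apply: adm; rewrite !ltW.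
Qed.

Lemma dilation_sum_slope_ge l i : 0 < l -> admissible c l -> c i != 0 ->
  c i * ((l * alpha i - 1) / 2) <= dilation_sum c slope l.
Proof.
move=> l0 adm ci; rewrite /dilation_sum (bigD1 i)//=.
apply: (@le_trans _ _ (c i * slope (l * alpha i))).
  by rewrite ler_wpM2l// slope_ge ?mulr_gt0 ?adm.
by rewrite lerDl sumr_ge0// => j _; rewrite mulr_ge0// slope_ge0// mulr_gt0.
Qed.

(* The values Num.truncn (l * alpha j / (2 * pi)) locate l between consecutive
   poles; on each such cell the sum is strictly convex. *)
Lemma finite_slope_level_gt0 z :
  finite_set [set l | [/\ 0 < l, admissible c l & dilation_sum c slope l = z]].
Proof.
set S := [set l | _]; pose cell l j := Num.truncn (l * alpha j / (pi *+ 2)).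
have [i ci] := c_neq0; pose M := (2 * ((c i)^-1 * z) + 1) / alpha i.
have leSM l : S l -> l <= M.
  move=> [l0 adm lz]; have ci0 : 0 < c i by rewrite lt_neqAle eq_sym ci c_ge0.
  have := dilation_sum_slope_ge l0 adm ci; rewrite lz -ler_pdivlMl// => le_z.
  by rewrite ler_pdivlMr//; lra.
pose N := (\sum_j cell M j)%N.
have cellN l j : S l -> (cell l j <= N)%N.
  move=> Sl; apply: (@leq_trans (cell M j)).
    by rewrite le_truncn// ler_pM2r ?invr_gt0 ?pi2_gt0// ler_pM2r// leSM.
  by rewrite /N (bigD1 j)//= leq_addr.
pose cells l : {ffun I -> 'I_N.+1} := [ffun j => inord (cell l j)].
have -> : S = \bigcup_(e in [set: {ffun I -> 'I_N.+1}])
    (S `&` [set l | cells l = e]).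
  by apply/seteqP; split => [l Sl|l [e _ []]//]; exists (cells l).
apply: bigcup_finite => [|e _]; first exact: finite_finset.
apply: finite_set_no_chain3 => l1 l2 l3 [S1 e1] [[_ _ z2] _] [S3 e3] l12 l23.
have [l10 adm1 z1] := S1; have [_ _ z3] := S3.
apply: (dilation_sum_slope_convex l10 l12 l23); rewrite ?z1 ?z2 ?z3//.
move=> l /andP[l1l ll3] j cj.
apply: (@cos_neq1_between _ (l1 * alpha j) (l3 * alpha j)); last exact: adm1.
- by rewrite mulr_gt0.
- by rewrite !ler_pM2r// l1l.
- move: e3; rewrite -e1 => /ffunP/(_ j); rewrite !ffunE => /(congr1 val) /=.
  by rewrite !inordK ?ltnS ?cellN// => ->.
Qed.

Lemma finite_slope_level z :
  finite_set [set l | [/\ l != 0, admissible c l & dilation_sum c slope l = z]].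
Proof.
pose F y := [set l | [/\ 0 < l, admissible c l & dilation_sum c slope l = y]].
apply: (@sub_finite_set _ _ [set l | (F z `|` F (- z)) `|l|]); last first.
  by apply: finite_preimage_normr; rewrite finite_setU; split;
    exact: finite_slope_level_gt0.
move=> l [l_neq0 adm lz]; case: (ltgtP l 0) l_neq0 => // l0 _; last first.
  by rewrite /= gtr0_norm//; left.
rewrite /= ltr0_norm//; right; split; first by rewrite oppr_gt0.
  by move=> j cj; rewrite mulNr cosN adm.
rewrite -lz /dilation_sum -sumrN; apply: eq_bigr => j _.
by rewrite mulNr slopeN mulrN.
Qed.

End DilationSum.

(** * The Hamiltonian flow *)

Section SkewCalculus.
Context {R : realType} {m : nat} {I : finType} (A : 'M[R]_m).
Context (alpha : I -> R) (P : I -> 'M[R]_m) (AP : skew_resolution A alpha P).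
Implicit Types (a b c d : I -> R) (u : 'rV[R]_m).

(* On the range of P j this is the complex number a j + i alpha j b j, where
   i = A / alpha j. *)
Definition skew_mx a b : 'M[R]_m := \sum_j (a j *: P j + b j *: (P j *m A)).

Lemma eq_skew_mx a b c d : a =1 c -> b =1 d -> skew_mx a b = skew_mx c d.
Proof. by move=> ac bd; apply: eq_bigr => j _; rewrite ac bd. Qed.

Lemma skew_mx1 : skew_mx (fun=> 1) (fun=> 0) = 1%:M.
Proof.
rewrite -(resolution_sum AP); apply: eq_bigr => j _.
by rewrite scale1r scale0r addr0.
Qed.

Lemma scale_skew_mx (r : R) a b :
  r *: skew_mx a b = skew_mx (fun j => r * a j) (fun j => r * b j).
Proof.
by rewrite scaler_sumr; apply: eq_bigr => j _; rewrite scalerDr !scalerA.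
Qed.

Lemma tr_skew_mx a b : (skew_mx a b)^T = skew_mx a (fun j => - b j).
Proof.
rewrite linear_sum; apply: eq_bigr => j _; rewrite linearD !linearZ /= trmx_mul.
rewrite (resolution_sym AP) (resolution_skew AP) mulNmx (resolution_comm AP).
by rewrite scalerN scaleNr.
Qed.

Lemma mulmx_skew_mx u a b : u *m skew_mx a b =
  \sum_j (a j *: (u *m P j) + b j *: (u *m P j *m A)).
Proof.
rewrite mulmx_sumr; apply: eq_bigr => j _.
by rewrite mulmxDr -!scalemxAr mulmxA.
Qed.

Lemma proj_mul_skew_mx j a b :
  P j *m skew_mx a b = a j *: P j + b j *: (P j *m A).
Proof.
rewrite mulmx_sumr (bigD1 j)//= big1 => [|i ij]; last first.
  rewrite mulmxDr -!scalemxAr mulmxA (resolution_mul AP) eq_sym (negbTE ij).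
  by rewrite mul0mx !scaler0 addr0.
by rewrite addr0 mulmxDr -!scalemxAr mulmxA (resolution_mul AP) eqxx.
Qed.

Lemma skew_mxM a b c d : skew_mx a b *m skew_mx c d =
  skew_mx (fun j => a j * c j - alpha j ^+ 2 * (b j * d j))
          (fun j => a j * d j + b j * c j).
Proof.
rewrite {1}/skew_mx mulmx_suml; apply: eq_bigr => j _.
rewrite mulmxDl -!scalemxAl proj_mul_skew_mx (resolution_comm AP) -mulmxA.
rewrite proj_mul_skew_mx mulmxDr -!scalemxAr mulmxA -!(resolution_comm AP).
rewrite (resolution_sqr AP); apply/matrixP => x y; rewrite !mxE; ring.
Qed.

Lemma skew_mx_mulA a b :
  skew_mx a b *m A = skew_mx (fun j => - (alpha j ^+ 2 * b j)) a.
Proof.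
rewrite mulmx_suml; apply: eq_bigr => j _; rewrite mulmxDl -!scalemxAl.
by rewrite (resolution_sqr AP) scalerA addrC mulrN mulrC.
Qed.

Lemma sum_proj (Q : pred I) :
  \sum_(j | Q j) P j = skew_mx (fun j => (Q j)%:R) (fun=> 0).
Proof.
rewrite big_mkcond; apply: eq_bigr => j _; rewrite scale0r addr0.
by case: (Q j); rewrite ?scale1r ?scale0r.
Qed.

Lemma skew_mxC a b c d :
  skew_mx a b *m skew_mx c d = skew_mx c d *m skew_mx a b.
Proof. by rewrite !skew_mxM; apply: eq_skew_mx => j; ring. Qed.

Lemma dot_proj u j : dot u (u *m P j) = sqnorm (u *m P j).
Proof.
rewrite sqnormE dot_mulmx (resolution_sym AP) -mulmxA (resolution_mul AP).
by rewrite eqxx.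
Qed.

Lemma dot_proj_mulA u j : dot u (u *m P j *m A) = 0.
Proof.
rewrite -[P j](_ : P j *m P j = _); last by rewrite (resolution_mul AP) eqxx.
rewrite mulmxA -mulmxA (resolution_comm AP) mulmxA -{2}(resolution_sym AP).
by rewrite -dot_mulmx dotC (skew_dot0 _ (resolution_skew AP)).
Qed.

Lemma dot_skew_mx u a b c d : dot (u *m skew_mx a b) (u *m skew_mx c d) =
  \sum_j (a j * c j + alpha j ^+ 2 * (b j * d j)) * sqnorm (u *m P j).
Proof.
rewrite dot_mulmx tr_skew_mx -mulmxA skew_mxM mulmx_skew_mx dot_sumr.
apply: eq_bigr => j _; rewrite dotDr !dotZr dot_proj dot_proj_mulA; ring.
Qed.

Lemma sqnorm_skew_mx u a b : sqnorm (u *m skew_mx a b) =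
  \sum_j (a j ^+ 2 + alpha j ^+ 2 * b j ^+ 2) * sqnorm (u *m P j).
Proof. by rewrite sqnormE dot_skew_mx. Qed.

Lemma sqnorm_sum_proj u : sqnorm u = \sum_j sqnorm (u *m P j).
Proof.
rewrite -[u in LHS]mulmx1 -skew_mx1 sqnorm_skew_mx; apply: eq_bigr => j _.
by rewrite expr1n expr0n mulr0 addr0 mul1r.
Qed.

Lemma sqnorm_skew_mx_mulP u a b j : sqnorm (u *m skew_mx a b *m P j) =
  (a j ^+ 2 + alpha j ^+ 2 * b j ^+ 2) * sqnorm (u *m P j).
Proof.
have PjE : P j = skew_mx (fun i => (i == j)%:R) (fun=> 0).
  by rewrite -sum_proj big_pred1_eq.
rewrite -mulmxA {1}PjE skew_mxC -PjE mulmxA sqnorm_skew_mx.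
rewrite (bigD1 j)//= big1 => [|i ij].
  by rewrite addr0 -mulmxA (resolution_mul AP) eqxx.
by rewrite -mulmxA (resolution_mul AP) eq_sym (negbTE ij) mulmx0 sqnorm0 mulr0.
Qed.

Lemma has_der_skew_mx u (a b : I -> R -> R) a' b' (t : R) :
  (forall j, has_der t 1 (a j) (a' j)) ->
  (forall j, has_der t 1 (b j) (b' j)) ->
  has_der t 1 (fun t => u *m skew_mx (fun j => a j t) (fun j => b j t))
    (u *m skew_mx a' b').
Proof.
move=> da db.
have -> : (fun t => u *m skew_mx (fun j => a j t) (fun j => b j t)) =
    (fun t => \sum_j (a j t *: (u *m P j) + b j t *: (u *m P j *m A))).
  by apply/funext => r; rewrite mulmx_skew_mx.
rewrite mulmx_skew_mx; apply: has_der_sum => j.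
by apply: has_derD; [exact: has_derZl (da j)|exact: has_derZl (db j)].
Qed.

End SkewCalculus.

Section HamiltonianField.
Context {R : realType} {m : nat} (A : 'M[R]_m) (A_skew : A^T = - A).
Implicit Types (q eta : coords R m) (s : coords R m * coords R m).
Implicit Types c : R -> coords R m * coords R m.

Definition momentum s : 'rV[R]_m := s.2.1 + (s.2.2 / 2) *: (s.1.1 *m A).

Lemma pairing_frame s i : pairing s.2 (frame A i s.1) = momentum s 0 i.
Proof.
rewrite /frame left_fieldE pairingE /= add0r /dot trmx_delta -!colE.
by rewrite !mxE mulrA.
Qed.

Lemma hamiltonianE s : hamiltonian A s = 2^-1 * sqnorm (momentum s).
Proof. by congr (_ * _); apply: eq_bigr => i _; rewrite pairing_frame. Qed.

Lemma gradient_half_sqnorm (f : coords R m -> R^o) (w : coords R m -> 'rV[R]_m)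
    q (d : 'I_m -> 'rV[R]_m) (d0 : 'rV[R]_m) :
  (forall q, f q = 2^-1 * sqnorm (w q)) ->
  (forall i, has_der q (delta_mx 0 i, 0) w (d i)) -> has_der q (0, 1) w d0 ->
  gradient f q = (\row_i dot (w q) (d i), dot (w q) d0).
Proof.
move=> /funext -> wd wd0.
have derive_half_sqnorm v e : has_der q v w e ->
    'D_v (fun q => 2^-1 * sqnorm (w q) : R^o) q = dot (w q) e.
  move=> /has_der_sqnorm/(has_derZ 2^-1) [_ dE].
  by rewrite [LHS]dE /GRing.scale /=; field.
by apply: (congr2 pair); [apply/rowP => i; rewrite !mxE|]; exact: derive_half_sqnorm.
Qed.

Lemma hamiltonian_fieldE s : hamiltonian_field A s =
  ((momentum s, 2^-1 * dot (s.1.1 *m A) (momentum s)),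
   ((s.2.2 / 2) *: (momentum s *m A), 0)).
Proof.
case: s => [[x z] [xi l]]; apply: (congr2 pair) => /=.
  rewrite (@gradient_half_sqnorm _ (fun eta => momentum ((x, z), eta)) _
    (fun i => delta_mx 0 i) (2^-1 *: (x *m A))).
  - apply: (congr2 pair); last by rewrite dotZr dotC.
    by apply/rowP => i; rewrite mxE /dot trmx_delta -colE mxE.
  - by move=> eta; rewrite hamiltonianE.
  - move=> i; apply: has_der_affine => h.
    by rewrite /momentum /= scaler0 add0r -addrA addrC.
  - apply: has_der_affine => h.
    rewrite /momentum /= scaler0 add0r [h *: 1]mulr1 mulrDl scalerDl.
    by rewrite addrA scalerA addrAC.
rewrite (@gradient_half_sqnorm _ (fun q => momentum (q, (xi, l))) _
  (fun i => (l / 2) *: row i A) 0).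
- rewrite -[LHS]/(- _, - _) dot0r oppr0; apply: (congr2 pair) => //.
  apply/rowP => i; rewrite !mxE dotZr -mulrN dotE -sumrN; congr (_ * _).
  apply: eq_bigr => j _; rewrite -mulrN [row i A 0 j]mxE.
  by rewrite -[A in LHS]opprK -A_skew !mxE opprK.
- by move=> q; rewrite hamiltonianE.
- move=> i; apply: has_der_affine => h.
  rewrite /momentum /= mulmxDl -scalemxAl -rowE scalerDr !scalerA.
  by rewrite addrA addrAC [h * _]mulrC.
- apply: has_der_affine => h.
  by rewrite /momentum /= !scaler0 add0r addr0.
Qed.

Lemma integral_curve_has_der c (t : R) : integral_curve A c ->
  [/\ has_der t 1 (fun t => (c t).1.1) (momentum (c t)),
      has_der t 1 (fun t => (c t).1.2)
        (2^-1 * dot ((c t).1.1 *m A) (momentum (c t))),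
      has_der t 1 (fun t => (c t).2.1)
        (((c t).2.2 / 2) *: (momentum (c t) *m A)) &
      has_der t 1 (fun t => (c t).2.2) 0].
Proof.
move=> /(_ t); rewrite hamiltonian_fieldE => dc.
have dq := has_der_fst dc; have deta := has_der_snd dc.
split; [exact: has_der_fst dq|exact: has_der_snd dq|exact: has_der_fst deta|].
exact: has_der_snd deta.
Qed.

Lemma integral_curve_vertical c t : integral_curve A c -> (c t).2.2 = (c 0).2.2.
Proof.
move=> ic; apply: (@is_derive_0_is_cst R (fun t => (c t).2.2)) => r.
by have [] := integral_curve_has_der r ic.
Qed.

Lemma has_der_momentum c (t : R) : integral_curve A c ->
  has_der t 1 (fun t => momentum (c t)) ((c 0).2.2 *: (momentum (c t) *m A)).
Proof.
move=> ic; set l := (c 0).2.2.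
have -> : (fun t => momentum (c t)) =
    (fun t => (c t).2.1 + (l / 2) *: ((c t).1.1 *m A)).
  by apply/funext => r; rewrite /momentum integral_curve_vertical.
have [dx _ dxi _] := integral_curve_has_der t ic.
apply: has_der_eq; first exact: has_derD dxi (has_derZ _ (has_der_mulmx A dx)).
by rewrite integral_curve_vertical// -/l -scalerDl -splitr.
Qed.

(* Since A is skew, the distance between the momenta of two curves with the
   same vertical covector is constant; this replaces a Gronwall argument. *)
Lemma momentum_unique c1 c2 : integral_curve A c1 -> integral_curve A c2 ->
  c1 0 = c2 0 -> forall t, momentum (c1 t) = momentum (c2 t).
Proof.
move=> ic1 ic2 c12 t; pose w t := momentum (c1 t) - momentum (c2 t).
have w'0 (r : R) : has_der r 1 (fun t => sqnorm (w t)) 0.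
  apply: has_der_eq.
    apply: has_der_sqnorm.
    apply: has_derD (has_der_momentum r ic1) _.
    exact: has_derN (has_der_momentum r ic2).
  by rewrite /= -c12 -scalerBr -mulmxBl -/(w r) dotZr dotC skew_dot0// !mulr0.
apply/eqP; rewrite -subr_eq0 -sqnorm_eq0 (is_derive_0_is_cst t 0 w'0).
by rewrite /w c12 subrr sqnorm0.
Qed.

Lemma integral_curve_unique c1 c2 :
  integral_curve A c1 -> integral_curve A c2 -> c1 0 = c2 0 -> c1 = c2.
Proof.
move=> ic1 ic2 c12; have mu12 := momentum_unique ic1 ic2 c12.
have x12 : (fun t => (c1 t).1.1) = (fun t => (c2 t).1.1).
  apply: (row_antiderivative_unique (df := fun t => momentum (c1 t))) => [t|t|].
  - by have [] := integral_curve_has_der t ic1.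
  - by rewrite mu12; have [] := integral_curve_has_der t ic2.
  - by rewrite c12.
have z12 : (fun t => (c1 t).1.2) = (fun t => (c2 t).1.2).
  apply: (antiderivative_unique
    (df := fun t => 2^-1 * dot ((c1 t).1.1 *m A) (momentum (c1 t)))) => [t|t|].
  - by have [] := integral_curve_has_der t ic1.
  - rewrite mu12 (congr1 (@^~ t) x12).
    by have [] := integral_curve_has_der t ic2.
  - by rewrite c12.
apply/funext => t.
have x12t := congr1 (@^~ t) x12; have z12t := congr1 (@^~ t) z12.
have l12 : (c1 t).2.2 = (c2 t).2.2.
  rewrite (integral_curve_vertical t ic1) (integral_curve_vertical t ic2).
  by rewrite c12.
have xi12 : (c1 t).2.1 = (c2 t).2.1.
  by have := mu12 t; rewrite /momentum l12 x12t => /addIr.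
move: x12t z12t l12 xi12.
by case: (c1 t) => [[? ?] [? ?]]; case: (c2 t) => [[? ?] [? ?]] /= -> -> -> ->.
Qed.

End HamiltonianField.

Section ExplicitFlow.
Context {R : realType} {m : nat} {I : finType} (A : 'M[R]_m).
Context (alpha : I -> R) (P : I -> 'M[R]_m) (AP : skew_resolution A alpha P).
Context (u : 'rV[R]_m) (l : R).
Implicit Types (j : I) (t : R).

Definition rotation_re j t := cos (l * alpha j * t).
Definition rotation_im j t := sin (l * alpha j * t) / alpha j.

(* The rotation integrated from 0 to t: at l = 0 the limit value t of the real
   part must be imposed, while the imaginary part divides 0 by 0 there. *)
Definition displacement_re j t :=
  if l == 0 then t else sin (l * alpha j * t) / (l * alpha j).
Definition displacement_im j t :=
  (1 - cos (l * alpha j * t)) / (l * alpha j ^+ 2).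

Definition rotation t := skew_mx A P (rotation_re^~ t) (rotation_im^~ t).
Definition displacement t :=
  skew_mx A P (displacement_re^~ t) (displacement_im^~ t).
Definition height t := 2^-1 * \sum_j alpha j * sqnorm (u *m P j) *
  ((l * alpha j * t - sin (l * alpha j * t)) / (l * alpha j) ^+ 2).

Definition flow t : coords R m * coords R m :=
  ((u *m displacement t, height t),
   (u *m rotation t - (l / 2) *: (u *m displacement t *m A), l)).

Lemma has_der_rotation_re j t :
  has_der t 1 (rotation_re j) (l * - (alpha j ^+ 2 * rotation_im j t)).
Proof.
apply: has_der_eq; first by rewrite /rotation_re; derive_rules.
by rewrite /rotation_im /=; field; rewrite gt_eqF// (resolution_gt0 AP).
Qed.

Lemma has_der_rotation_im j t :
  has_der t 1 (rotation_im j) (l * rotation_re j t).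
Proof.
apply: has_der_eq; first by rewrite /rotation_im; derive_rules.
by rewrite /rotation_re /=; field; rewrite gt_eqF// (resolution_gt0 AP).
Qed.

Lemma has_der_displacement_re j t :
  has_der t 1 (displacement_re j) (rotation_re j t).
Proof.
rewrite /displacement_re /rotation_re; have [->|l0] := eqVneq l 0.
  by rewrite !mul0r cos0; exact: has_der_id.
apply: has_der_eq; first by derive_rules.
by rewrite /=; field; rewrite l0 gt_eqF// (resolution_gt0 AP).
Qed.

Lemma has_der_displacement_im j t :
  has_der t 1 (displacement_im j) (rotation_im j t).
Proof.
rewrite /displacement_im /rotation_im; have [->|l0] := eqVneq l 0.
  rewrite !mul0r sin0 mul0r invr0 (_ : (fun t => _) = fun=> 0).
    exact: has_der_cst.
  by apply/funext => r; rewrite mulr0.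
apply: has_der_eq; first by derive_rules.
by rewrite /=; field; rewrite l0 gt_eqF// (resolution_gt0 AP).
Qed.

Lemma has_der_displacement t :
  has_der t 1 (fun t => u *m displacement t) (u *m rotation t).
Proof.
apply: has_der_skew_mx => j; first exact: has_der_displacement_re.
exact: has_der_displacement_im.
Qed.

Lemma has_der_rotation t :
  has_der t 1 (fun t => u *m rotation t) (l *: (u *m rotation t *m A)).
Proof.
rewrite -mulmxA (skew_mx_mulA AP) scalemxAr scale_skew_mx.
apply: has_der_skew_mx => j; first exact: has_der_rotation_re.
exact: has_der_rotation_im.
Qed.

Lemma has_der_height t : has_der t 1 height
  (2^-1 * dot (u *m displacement t *m A) (u *m rotation t)).
Proof.
rewrite -mulmxA (skew_mx_mulA AP) (dot_skew_mx AP); apply: has_der_eq.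
  rewrite /height; apply: has_derM; first exact: has_der_cst.
  apply: has_der_sum => j; apply: has_derM; first exact: has_der_cst.
  by derive_rules.
rewrite [X in _ + X = _]mulr0 addr0; congr (_ * _); apply: eq_bigr => j _ /=.
rewrite /displacement_re /displacement_im /rotation_re /rotation_im.
have [->|l0] := eqVneq l 0.
  by rewrite !mul0r sin0 cos0 expr0n /= invr0; ring.
by field: (sin2cos2 (l * alpha j * t)); rewrite l0 gt_eqF// (resolution_gt0 AP).
Qed.

Lemma momentum_flow t : momentum A (flow t) = u *m rotation t.
Proof. by rewrite /momentum /= subrK. Qed.

Lemma integral_curve_flow : integral_curve A flow.
Proof.
move=> t; rewrite (hamiltonian_fieldE (resolution_skew AP)) momentum_flow.
apply: has_der_pair; apply: has_der_pair; last exact: has_der_cst.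
- exact: has_der_displacement.
- exact: has_der_height.
- apply: has_der_eq.
    apply: has_derD (has_der_rotation t) _.
    exact/has_derN/has_derZ/has_der_mulmx/has_der_displacement.
  by rewrite -scalerBl; congr (_ *: _); rewrite /=; field.
Qed.

Lemma flow0 : flow 0 = (0, (u, l)).
Proof.
have disp0 : displacement 0 = 0.
  apply: big1 => j _; rewrite /displacement_re /displacement_im mulr0 sin0 cos0.
  by rewrite subrr !mul0r; case: ifP => _; rewrite !scale0r addr0.
have rot0 : rotation 0 = 1%:M.
  rewrite -(skew_mx1 AP); apply: eq_skew_mx => j.
    by rewrite /rotation_re mulr0 cos0.
  by rewrite /rotation_im mulr0 sin0 mul0r.
have height0 : height 0 = 0.
  by rewrite /height big1 ?mulr0// => j _; rewrite mulr0 sin0 subrr mul0r mulr0.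
by rewrite /flow disp0 rot0 height0 mulmx1 mulmx0 mul0mx scaler0 subr0.
Qed.

Lemma extremalE : extremal A (u, l) = flow.
Proof.
have [|ic c0] := @xgetPex _ (fun=> (0, (u, l)))
  [set c | integral_curve A c /\ c 0 = (0, (u, l))].
  by exists flow; split; [exact: integral_curve_flow|exact: flow0].
apply: (integral_curve_unique (resolution_skew AP) ic integral_curve_flow).
by rewrite c0 flow0.
Qed.

Lemma exp_mapE : exp_map A (u, l) = (u *m displacement 1, height 1).
Proof. by rewrite /exp_map /geodesic extremalE. Qed.

Lemma sqnorm_rotation t : sqnorm (u *m rotation t) = sqnorm u.
Proof.
rewrite (sqnorm_skew_mx AP) (sqnorm_sum_proj AP); apply: eq_bigr => j _.
rewrite /rotation_re /rotation_im (_ : _ + _ = 1) ?mul1r//.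
by field: (sin2cos2 (l * alpha j * t)); rewrite gt_eqF// (resolution_gt0 AP).
Qed.

Lemma derive1_geodesic t : (derive1 (geodesic A (u, l)) t).1 = u *m rotation t.
Proof.
have := integral_curve_flow t.
rewrite (hamiltonian_fieldE (resolution_skew AP)) momentum_flow => /has_der_fst.
by rewrite derive1E /geodesic extremalE => -[_ ->].
Qed.

Lemma energyE : energy (geodesic A (u, l)) = 2^-1 * sqnorm u.
Proof.
rewrite /energy; congr (_ * _).
under eq_Rintegral do rewrite derive1_geodesic sqnorm_rotation.
rewrite Rintegral_cst; last exact: measurable_itv.
have := @lebesgue_measure_itv R `[0, 1]; rewrite /= lte01 oppr0 adde0 => ->.
by rewrite mulr1.
Qed.

End ExplicitFlow.

(** * Charts flattening spheres *)

Section RationalMaps.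
Context {R : realType} {V W : normedModType R} (U : set V).
Implicit Types (c : V -> R^o) (f g : V -> W).

Inductive rational_fun : (V -> R^o) -> Prop :=
| rational_cst r : rational_fun (fun=> r)
| rational_linear (L : {linear V -> R^o}) : continuous L -> rational_fun L
| rationalD c d :
    rational_fun c -> rational_fun d -> rational_fun (fun q => c q + d q)
| rationalM c d :
    rational_fun c -> rational_fun d -> rational_fun (fun q => c q * d q)
| rationalV c : rational_fun c -> (forall q, U q -> c q != 0) ->
    rational_fun (fun q => (c q)^-1).

Inductive rational_map : (V -> W) -> Prop :=
| rational_mapZ c w : rational_fun c -> rational_map (fun q => c q *: w)
| rational_mapD f g :
    rational_map f -> rational_map g -> rational_map (fun q => f q + g q).

Lemma rational_fun_differentiable c q :
  rational_fun c -> U q -> differentiable c q.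
Proof.
move=> rc Uq; elim: rc => {c} [r|L cL|c d _ dc _ dd|c d _ dc _ dd|c _ dc c0].
- exact: differentiable_cst.
- exact: linear_differentiable.
- exact: (differentiableD dc dd).
- exact: (differentiableM dc dd).
- exact: (differentiableV dc (c0 q Uq)).
Qed.

Lemma rational_fun_has_der c v : rational_fun c ->
  exists2 d, rational_fun d & forall q, U q -> has_der q v c (d q).
Proof.
elim=> {c} [r|L cL|c d rc [c' rc' cE] rd [d' rd' dE]
    |c d rc [c' rc' cE] rd [d' rd' dE]|c rc [c' rc' cE] c0].
- by exists (fun=> 0); [exact: rational_cst|move=> q _; exact: has_der_cst].
- exists (fun=> L v); first exact: rational_cst.
  by move=> q _; apply: has_der_affine => h; rewrite addrC linearD linearZ.
- exists (fun q => c' q + d' q); first exact: rationalD.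
  by move=> q Uq; apply: has_derD; [exact: cE|exact: dE].
- exists (fun q => c q * d' q + d q * c' q).
    by apply: rationalD; exact: rationalM.
  by move=> q Uq; apply: has_derM; [exact: cE|exact: dE].
- exists (fun q => - 1 * ((c q)^-1 * (c q)^-1) * c' q).
    have rV := rationalV rc c0.
    by do 2![apply: rationalM => //]; [exact: rational_cst|exact: rationalM].
  move=> q Uq; apply: has_der_eq; first exact: has_derV (c0 q Uq) (cE q Uq).
  by rewrite expr2 mulN1r invfM.
Qed.

Lemma rational_map_differentiable f q :
  rational_map f -> U q -> differentiable f q.
Proof.
move=> rf Uq; elim: rf => {f} [c w rc|f g _ df _ dg].
  exact/differentiableZl/rational_fun_differentiable.
exact: (differentiableD df dg).
Qed.

Lemma rational_map_has_der f v : rational_map f ->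
  exists2 g, rational_map g & forall q, U q -> has_der q v f (g q).
Proof.
elim=> {f} [c w /(rational_fun_has_der v) [c' rc' cE]
    |f g rf [f' rf' fE] rg [g' rg' gE]].
  exists (fun q => c' q *: w); first exact: rational_mapZ.
  by move=> q Uq; apply: has_derZl; exact: cE.
exists (fun q => f' q + g' q); first exact: rational_mapD.
by move=> q Uq; apply: has_derD; [exact: fE|exact: gE].
Qed.

Lemma rational_map_scale c f :
  rational_fun c -> rational_map f -> rational_map (fun q => c q *: f q).
Proof.
move=> rc; elim=> {f} [d w rd|f g _ rf _ rg].
  rewrite (_ : (fun q => _) = fun q => (c q * d q) *: w).
    exact/rational_mapZ/rationalM.
  by apply/funext => q; rewrite scalerA.
rewrite (_ : (fun q => _) = fun q => c q *: f q + c q *: g q).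
  exact: rational_mapD.
by apply/funext => q; rewrite scalerDr.
Qed.

Lemma rational_map_cst w : rational_map (fun=> w).
Proof.
rewrite (_ : (fun=> w) = fun=> 1 *: w); last by rewrite scale1r.
exact/rational_mapZ/rational_cst.
Qed.

Lemma rational_fun_sum (I : finType) (c : I -> V -> R^o) :
  (forall i, rational_fun (c i)) -> rational_fun (fun q => \sum_i c i q).
Proof.
move=> rc; rewrite (_ : (fun q => _) = \sum_i c i).
  elim/big_ind: _ => [|d e rd re|i _]; last exact: rc.
    exact: rational_cst.
  exact: rationalD.
by apply/funext => q; rewrite fct_sumE.
Qed.

Lemma rational_map_sum (I : finType) (f : I -> V -> W) :
  (forall i, rational_map (f i)) -> rational_map (fun q => \sum_i f i q).
Proof.
move=> rf; rewrite (_ : (fun q => _) = \sum_i f i).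
  elim/big_ind: _ => [|g h rg rh|i _]; last exact: rf.
    exact: rational_map_cst.
  exact: rational_mapD.
by apply/funext => q; rewrite fct_sumE.
Qed.

Lemma rational_map_iter_derive f (vs : seq V) : open U -> rational_map f ->
  exists2 g, rational_map g &
    forall q, U q -> foldr (fun v h => 'D_v h) f vs q = g q.
Proof.
move=> oU rf; elim: vs => [|v vs [g rg fg]]; first by exists f.
have [g' rg' gg'] := rational_map_has_der v rg.
exists g' => // q Uq; have [_ <-] := gg' q Uq.
apply: near_eq_derive; near=> y; apply: fg; near: y.
exact: open_nbhs_nbhs.
Unshelve. all: by end_near. Qed.

End RationalMaps.

Lemma near_eq_differentiable (R : realType) (V W : normedModType R)
    (f g : V -> W) (x : V) :
  (\near x, f x = g x) -> differentiable g x -> differentiable f x.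
Proof.
move=> fg /diff_locallyP[cd gd].
have fgx : f x = g x by exact: (nbhs_singleton fg).
have fd : f \o shift x = cst (f x) + 'd g x +o_ (0 : V) id.
  move/eqaddoP: gd => gd; apply/eqaddoP => e e0.
  have := gd e e0; apply: filter_app.
  have fg0 : \forall h \near (0 : V), f (h + x) = g (h + x).
    by move: fg; rewrite (near_shift 0 x) subr0.
  apply: filterS fg0 => h fgh.
  by rewrite !fctE /= fgh fgx.
by apply/diff_locallyP; rewrite (diff_unique cd fd).
Qed.

Section Pairing.
Context {R : realType} {m : nat}.
Local Notation V := (coords R m).
Implicit Types p q r : V.

Lemma pairingC p q : pairing p q = pairing q p.
Proof. by rewrite !pairingE dotC mulrC. Qed.

Lemma pairing_linear p : linear (pairing p : V -> R^o).
Proof.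
by move=> a q r; rewrite !pairingE /= dotDr dotZr /GRing.scale /=; ring.
Qed.

HB.instance Definition _ p :=
  GRing.isLinear.Build R V R^o *:%R (pairing p) (pairing_linear p).

Lemma pairingDr p q r : pairing p (q + r) = pairing p q + pairing p r.
Proof. exact: linearD. Qed.

Lemma pairingZr (a : R) p q : pairing p (a *: q) = a * pairing p q.
Proof. exact: (linearZ_LR (pairing p : {linear V -> R^o})). Qed.

Lemma pairingDl p q r : pairing (p + q) r = pairing p r + pairing q r.
Proof. by rewrite ![pairing _ r]pairingC pairingDr. Qed.

Lemma pairingZl (a : R) p q : pairing (a *: p) q = a * pairing p q.
Proof. by rewrite ![pairing _ q]pairingC pairingZr. Qed.

Lemma pairing_eq0 q : (pairing q q == 0) = (q == 0).
Proof.
rewrite pairingE -sqnormE -expr2 paddr_eq0 ?sqnorm_ge0 ?sqr_ge0//.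
by rewrite sqnorm_eq0 sqrf_eq0; case: q => x z /=; rewrite -pair_eqE.
Qed.

Lemma pairing_coord q i : pairing (delta_mx 0 i, 0) q = q.1 0 i.
Proof. by rewrite pairingE /= mul0r addr0 dotC /dot trmx_delta -colE mxE. Qed.

Lemma pairing_vert q : pairing (0, 1) q = q.2.
Proof. by rewrite pairingE /= dot0l add0r mul1r. Qed.

Lemma continuous_pairing p : continuous (pairing p : V -> R^o).
Proof.
move=> q; apply: (@continuousD _ R^o V (fun q => \sum_i p.1 0 i * q.1 0 i)).
  move: q; apply: continuous_big => [|i _ x]; first exact: add_continuous.
  apply: cvgM.
    exact: cvg_cst.
  apply: (@continuous_comp _ _ _ (fst : V -> 'rV[R]_m) (fun u => u 0 i)).
    exact: cvg_fst.
  exact: coord_continuous.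
by apply: cvgM; [exact: cvg_cst|exact: cvg_snd].
Qed.

Lemma coords_sum_pairing q : q =
  \sum_i pairing (delta_mx 0 i, 0) q *: ((delta_mx 0 i, 0) : V) +
  pairing (0, 1) q *: ((0, 1) : V).
Proof.
under eq_bigr do rewrite pairing_coord.
have -> : \sum_i q.1 0 i *: ((delta_mx 0 i, 0) : V) = (q.1, 0).
  rewrite [q.1 in RHS]row_sum_delta.
  apply: (big_ind2 (fun (x : V) y => x = (y, 0))) => // [x y x' y' -> ->|i _].
    by rewrite -[LHS]/(y + y', 0 + 0 :> R^o) addr0.
  by rewrite -[LHS]/(q.1 0 i *: delta_mx 0 i, q.1 0 i *: 0 :> R^o) scaler0.
rewrite pairing_vert -[RHS]/(q.1 + q.2 *: 0, 0 + q.2 * 1 :> R^o).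
by rewrite scaler0 addr0 add0r mulr1 -surjective_pairing.
Qed.

Section RationalCoords.
Context (U : set V).

Lemma rational_pairing p : rational_fun U (pairing p).
Proof.
apply: (@rational_linear _ _ U (pairing p : {linear V -> R^o})).
exact: continuous_pairing.
Qed.

Lemma rational_map_shift (c : V) : rational_map U (fun q => q + c).
Proof.
apply: rational_mapD; last exact: rational_map_cst.
rewrite (_ : (fun q => q) = fun q : V =>
    \sum_i pairing (delta_mx 0 i, 0) q *: ((delta_mx 0 i, 0) : V) +
    pairing (0, 1) q *: ((0, 1) : V)); last first.
  by apply/funext => q; exact: coords_sum_pairing.
apply: rational_mapD; last exact/rational_mapZ/rational_pairing.
by apply: rational_map_sum => i; exact/rational_mapZ/rational_pairing.
Qed.

Lemma rational_sqr_pairing (c : V) :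
  rational_fun U (fun q => pairing (q - c) (q - c)).
Proof.
have shift_coord p : rational_fun U (fun q : V => pairing p (q - c)).
  rewrite (_ : (fun q => _) = fun q => pairing p q + pairing p (- c)).
    by apply: rationalD; [exact: rational_pairing|exact: rational_cst].
  by apply/funext => q; rewrite pairingDr.
pose e i : V := (delta_mx 0 i, 0).
rewrite (_ : (fun q => _) = fun q =>
    \sum_i pairing (e i) (q - c) * pairing (e i) (q - c) +
    pairing (0, 1) (q - c) * pairing (0, 1) (q - c)).
  apply: rationalD; last exact: rationalM.
  by apply: rational_fun_sum => i; exact: rationalM.
apply/funext => q; rewrite pairing_vert.
by congr (_ + _); apply: eq_bigr => i _; rewrite pairing_coord.
Qed.

Lemma rational_map_smooth_on (f : V -> V) :
  open U -> rational_map U f -> smooth_on U f.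
Proof.
move=> oU rf vs q Uq; have [g rg fg] := rational_map_iter_derive vs oU rf.
apply: near_eq_differentiable (rational_map_differentiable rg Uq).
by near=> y; apply: fg; near: y; exact: open_nbhs_nbhs.
Unshelve. all: by end_near. Qed.

End RationalCoords.

Lemma smooth_on_shift (U : set V) (c : V) :
  open U -> smooth_on U (fun q => q + c).
Proof.
by move=> oU; apply: rational_map_smooth_on => //; exact: rational_map_shift.
Qed.

Lemma smooth_on_subset (U U' : set V) (f : V -> V) :
  U `<=` U' -> smooth_on U' f -> smooth_on U f.
Proof. by move=> UU' sf vs q /UU'; exact: sf. Qed.

Lemma open_setC1 (q : V) : open (~` [set q]).
Proof.
by apply: closed_openC; apply: finite_set_closed; exact: finite_set1.
Qed.

Definition inversion q : V := (pairing q q)^-1 *: q.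

Lemma inversionK : involutive inversion.
Proof.
move=> q; have [->|q0] := eqVneq q 0; first by rewrite /inversion !scaler0.
rewrite /inversion pairingZl pairingZr scalerA (_ : _ * _ = 1) ?scale1r//.
by field; rewrite pairing_eq0.
Qed.

Lemma inversion_eq0 q : (inversion q == 0) = (q == 0).
Proof. by rewrite scaler_eq0 invr_eq0 pairing_eq0 orbb. Qed.

Lemma inversion_in_vspace (S : {vspace V}) q : (inversion q \in S) = (q \in S).
Proof.
apply/idP/idP => [iS|]; last exact: memvZ.
by rewrite -[q]inversionK; exact: memvZ.
Qed.

(* The sphere centred at p through the origin is |q|^2 = 2 <p, q>, and dividing
   by |q|^2 gives an affine hyperplane. *)
Lemma inversion_sphere p q : q != 0 ->
  (pairing (q - p) (q - p) == pairing p p) = (pairing p (inversion q) == 2^-1).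
Proof.
rewrite -pairing_eq0 => q0; rewrite pairingZr -scaleN1r.
rewrite pairingDl !pairingDr !pairingZl !pairingZr (pairingC q p).
apply/eqP/eqP => [sphere_q|hyperplane_q].
  have -> : pairing p q = pairing q q / 2 by lra.
  by field.
have -> : pairing p q = pairing q q / 2.
  by rewrite -hyperplane_q mulrA divff ?mul1r.
by field.
Qed.

Lemma smooth_on_inversion (p r : V) :
  smooth_on (~` [set p]) (fun q => inversion (q - p) + r).
Proof.
apply: rational_map_smooth_on; first exact: open_setC1.
apply: rational_mapD; last exact: rational_map_cst.
apply: rational_map_scale; last exact: rational_map_shift.
apply: rationalV; first exact: rational_sqr_pairing.
by move=> q /eqP qp; rewrite pairing_eq0 subr_eq0.
Qed.

End Pairing.

Section SliceCharts.
Context {R : realType} {m : nat}.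
Local Notation V := (coords R m).
Implicit Types (S T B : set V) (q : V).

Definition slice_chart S q : Prop :=
  exists (U V' : set V) (phi psi : V -> V) (W : {vspace V}),
  [/\ [/\ open U, open V' & U q],
      smooth_on U phi /\ smooth_on V' psi,
      (forall x, U x -> V' (phi x) /\ psi (phi x) = x),
      (forall y, V' y -> U (psi y) /\ phi (psi y) = y) &
      (forall x, U x -> (S x <-> phi x \in W))].

Lemma submanifold_slice_chart S :
  (forall q, S q -> slice_chart S q) -> submanifold S.
Proof.
move=> chartS q /chartS[U [V' [phi [psi [W [oUV smooth UV VU SW]]]]]].
exists U, V', phi, psi, W; split=> //.
apply/seteqP; split=> [_ [x [Sx Ux] <-]|y [Vy Wy]].
  by split; [have [] := UV x Ux|exact/SW].
have [Uy phiy] := VU y Vy; exists (psi y) => //; split=> //.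
by apply/SW; rewrite ?phiy.
Qed.

Lemma slice_chart_local S T B q : open B -> B q ->
  (forall x, B x -> (S x <-> T x)) -> slice_chart T q -> slice_chart S q.
Proof.
move=> oB Bq ST [U [V' [phi [psi [W [[oU oV Uq] [sphi spsi] UV VU TW]]]]]].
have opsi : open (V' `&` psi @^-1` B).
  rewrite openE => y [Vy By]; apply: filterI; first exact: open_nbhs_nbhs.
  have cpsi : {for y, continuous psi}.
    exact: differentiable_continuous (spsi [::] y Vy).
  by apply: cpsi; exact: open_nbhs_nbhs.
exists (U `&` B), (V' `&` psi @^-1` B), phi, psi, W; split.
- by split=> //; exact: openI.
- split; first by apply: smooth_on_subset sphi; exact: subIsetl.
  by apply: smooth_on_subset spsi; exact: subIsetl.
- by move=> x [/UV[Vx phiK] Bx]; rewrite /= phiK.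
- by move=> y [/VU[Uy psiK] By].
- by move=> x [Ux Bx]; rewrite (ST x Bx); exact: TW.
Qed.

Lemma slice_chart_point q : slice_chart [set q] q.
Proof.
exists setT, setT, (fun x => x - q), (fun y => y + q), 0%VS; split=> //.
- by split=> //; exact: openT.
- by split; apply: smooth_on_shift; exact: openT.
- by move=> x _; rewrite subrK.
- by move=> y _; rewrite addrK.
- by move=> x _; rewrite memv0 subr_eq0; split=> [->//|/eqP].
Qed.

Lemma finite_submanifold S : finite_set S -> submanifold S.
Proof.
move=> finS; apply: submanifold_slice_chart => q Sq.
apply: (@slice_chart_local _ [set q] (~` (S `\ q))) (slice_chart_point q).
- by apply: closed_openC; apply: finite_set_closed; exact: finite_setD.
- by case=> _ /(_ erefl).
- move=> x Sx; split=> [Sx'|->//]; apply: contrapT => xq.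
  exact: Sx.
Qed.

(* Inversion about the point N antipodal to q maps the sphere minus N onto the
   affine hyperplane <q - o, y> = 1/2 of W. *)
Lemma slice_chart_round_sphere (W : {vspace V}) (o q : V) (r : R) : r != 0 ->
  q - o \in W -> pairing (q - o) (q - o) = r ->
  slice_chart [set x | x - o \in W /\ pairing (x - o) (x - o) = r] q.
Proof.
move=> r0; set w := q - o => wW wr; pose N := o - w; pose y0 := (2 * r)^-1 *: w.
pose phi x := inversion (x - N) + (- y0).
pose psi y := inversion (y - (- y0)) + N.
have phiK : cancel phi psi.
  by move=> x; rewrite /psi /phi addrK inversionK subrK.
have psiK : cancel psi phi.
  by move=> y; rewrite /psi /phi addrK inversionK subrK.
have w_neq0 : w != 0 by rewrite -pairing_eq0 wr.
have y0W : y0 \in W by exact: memvZ.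
have wNy0 : pairing w (- y0) = - 2^-1.
  by rewrite -scaleN1r !pairingZr wr; field.
exists (~` [set N]), (~` [set - y0]), phi, psi,
  (W :&: lker (linfun (pairing w : {linear V -> R^o})))%VS; split.
- split; [exact: open_setC1|exact: open_setC1|move=> qN].
  have : w = - w by rewrite {1}/w qN /N addrAC subrr add0r.
  move=> /eqP; rewrite -addr_eq0 -mulr2n -scaler_nat scaler_eq0 pnatr_eq0 /=.
  by rewrite (negbTE w_neq0).
- by split; exact: smooth_on_inversion.
- move=> x xN; split; last exact: phiK.
  move=> /eqP; rewrite -subr_eq0 addrK inversion_eq0 subr_eq0 => /eqP.
  exact: xN.
- move=> y yy0; split; last exact: psiK.
  move=> /eqP; rewrite -subr_eq0 addrK inversion_eq0 subr_eq0 => /eqP.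
  exact: yy0.
move=> x /eqP; rewrite -subr_eq0 => t0; set t := x - N in t0 *.
have xo : x - o = t - w by rewrite /t /N opprB addrA addrAC addrK.
have tW : (t - w \in W) = (t \in W) by rewrite rpredBr.
have phiW : (phi x \in W) = (t \in W).
  by rewrite /phi rpredBr// inversion_in_vspace.
have phiw : (pairing w (phi x) == 0) = (pairing (t - w) (t - w) == pairing w w).
  by rewrite inversion_sphere// pairingDr wNy0 subr_eq0.
rewrite /= memv_cap memv_ker lfunE /= phiW phiw xo tW wr.
by split=> [[-> /eqP ->]|/andP[-> /eqP ->]].
Qed.

End SliceCharts.

(** * Families of spheres over a locally finite set *)

Section Continuity.
Context {R : realType}.

Lemma continuous_mulmxr (n p : nat) (B : 'M[R]_(n, p)) :
  continuous (fun u : 'rV[R]_n => u *m B).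
Proof.
rewrite (_ : (fun u => _) = fun u : 'rV[R]_n => \sum_i u 0 i *: row i B).
  apply: continuous_big => [|i _ u]; first exact: add_continuous.
  apply: (@continuous_comp _ _ _ (fun u : 'rV[R]_n => u 0 i : R^o)
    (fun s => s *: row i B)).
    exact: coord_continuous.
  exact: scalel_continuous.
by apply/funext => u; rewrite mulmx_sum_row.
Qed.

Lemma continuous_sqnorm (n : nat) : continuous (@sqnorm R n : 'rV[R]_n -> R^o).
Proof.
apply: continuous_big => [|i _ u]; first exact: add_continuous.
apply: (@continuous_comp _ _ _ (fun u : 'rV[R]_n => u 0 i : R^o)
  (fun s => s ^+ 2)).
  exact: coord_continuous.
exact: exprn_continuous.
Qed.

Lemma continuous_fst_mulmx (m p : nat) (B : 'M[R]_(m, p)) :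
  continuous (fun q : coords R m => q.1 *m B).
Proof.
move=> q; apply: (@continuous_comp _ _ _ (fst : coords R m -> 'rV[R]_m)
  (fun u => u *m B)).
  exact: cvg_fst.
exact: continuous_mulmxr.
Qed.

Lemma open_slab (m : nat) (l e : R) :
  open [set q : coords R m | `|q.2 - l| < e].
Proof.
rewrite (_ : [set q : coords R m | _] =
    (snd : coords R m -> R^o) @^-1` (ball (l : R^o) e)).
  by apply: open_comp; [move=> q _; exact: cvg_snd|exact: ball_open].
by apply/seteqP; split=> q /=; rewrite /ball /= distrC.
Qed.

End Continuity.

Section SphereFibre.
Context {R : realType} {m : nat} (Q : 'M[R]_m) (a : 'rV[R]_m) (r l : R).
Local Notation V := (coords R m).

Definition sphere_fibre : set V :=
  [set q | [/\ q.2 = l, q.1 - q.1 *m Q = a & sqnorm (q.1 *m Q) = r]].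

Lemma closed_sphere_fibre : closed sphere_fibre.
Proof.
pose h (q : V) : R^o * 'rV[R]_m * R^o :=
  (q.2, q.1 - q.1 *m Q, sqnorm (q.1 *m Q)).
have -> : sphere_fibre = h @^-1` [set (l, a, r)].
  apply/seteqP; split=> q; last by case.
  by case=> ql qa qr; rewrite /h /= ql qa qr.
have cQ := @continuous_fst_mulmx R m m Q.
apply: preimage_closed => [q _|]; last first.
  by apply: finite_set_closed; exact: finite_set1.
have c2 : {for q, continuous (snd : V -> R^o)} by exact: cvg_snd.
have c1 : {for q, continuous (fun q : V => q.1 - q.1 *m Q)}.
  by apply: cvgB; [exact: cvg_fst|exact: cQ].
have cn : {for q, continuous (fun q : V => sqnorm (q.1 *m Q) : R^o)}.
  apply: (@continuous_comp _ _ _ (fun q : V => q.1 *m Q) (@sqnorm R m)).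
    exact: cQ.
  exact: continuous_sqnorm.
exact: cvg_pair (cvg_pair c2 c1) cn.
Qed.

Definition fibre_direction_defect (q : V) : V := (q.1 - q.1 *m Q, q.2).

Lemma fibre_direction_defect_linear : linear fibre_direction_defect.
Proof.
move=> c p q; apply: (congr2 pair) => //=.
by rewrite mulmxDl -scalemxAl scalerBr opprD addrACA.
Qed.

HB.instance Definition _ :=
  GRing.isLinear.Build R V V *:%R fibre_direction_defect
    fibre_direction_defect_linear.

Definition fibre_directions : {vspace V} :=
  lker (linfun fibre_direction_defect).

Lemma mem_fibre_directions q :
  q \in fibre_directions <-> q.1 *m Q = q.1 /\ q.2 = 0.
Proof.
rewrite memv_ker lfunE /=; split=> [/eqP[/eqP]|[qQ q2]].
  by rewrite subr_eq0 => /eqP {2}->.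
by rewrite /fibre_direction_defect qQ q2 subrr.
Qed.

Lemma sphere_fibre_round : Q *m Q = Q -> a *m Q = 0 -> sphere_fibre =
  [set q | q - (a, l) \in fibre_directions /\
    pairing (q - (a, l)) (q - (a, l)) = r].
Proof.
move=> Q_idem aQ; apply/seteqP; split=> q.
  move=> [ql qa qr].
  have qQ : q.1 - a = q.1 *m Q by rewrite -qa opprB addrC subrK.
  split; last by rewrite pairingE /= ql subrr mulr0 addr0 qQ -sqnormE.
  by apply/mem_fibre_directions; rewrite /= ql subrr qQ -mulmxA Q_idem.
rewrite /= => -[/mem_fibre_directions[/= qaQ /eqP]].
rewrite subr_eq0 => /eqP ql.
have qQ : q.1 *m Q = q.1 - a by rewrite -qaQ mulmxBl aQ subr0.
rewrite pairingE /= ql subrr mulr0 addr0 -sqnormE -qQ => qr; split=> //.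
by rewrite qQ opprB addrC subrK.
Qed.

Lemma slice_chart_sphere_fibre q : Q *m Q = Q -> a *m Q = 0 -> r != 0 ->
  sphere_fibre q -> slice_chart sphere_fibre q.
Proof.
move=> Q_idem aQ r0; rewrite sphere_fibre_round// => -[qdir qr].
exact: slice_chart_round_sphere.
Qed.

End SphereFibre.

Section SphereFamily.
Context {R : realType} {m : nat}.
Context (Q : R -> 'M[R]_m) (a : R -> 'rV[R]_m) (rho : R -> R) (D : set R).
Local Notation V := (coords R m).

Definition sphere_family : set V :=
  \bigcup_(l in D) sphere_fibre (Q l) (a l) (rho l) l.

Lemma sphere_familyP q :
  sphere_family q <-> D q.2 /\ sphere_fibre (Q q.2) (a q.2) (rho q.2) q.2 q.
Proof.
split=> [[l Dl fq]|[Dq fq]]; last by exists q.2.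
by have [ql _ _] := fq; rewrite ql.
Qed.

Lemma finite_sphere_family :
  finite_set D -> (forall l, D l -> rho l = 0) -> finite_set sphere_family.
Proof.
move=> finD rho0.
apply: sub_finite_set (finite_image (fun l => (a l, l) : V) finD).
move=> [u l] /sphere_familyP[/= Dl [_ /= ua]]; rewrite rho0// => /eqP.
by rewrite sqnorm_eq0 => /eqP uQ; exists l; rewrite // -ua uQ subr0.
Qed.

Hypothesis levels_locally_finite : locally_finite (snd @` sphere_family).

Lemma sphere_family_near_level l0 : exists2 e : R, 0 < e & forall q : V,
  `|q.2 - l0| < e ->
  (sphere_family q <-> D l0 /\ sphere_fibre (Q l0) (a l0) (rho l0) l0 q).
Proof.
have [e e0 iso] := locally_finite_isolated l0 levels_locally_finite.
exists e => // q qe; split=> [Fq|[Dl0 fq]]; last by exists l0.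
have <- : q.2 = l0 by apply: iso => //; exists q.
exact/sphere_familyP.
Qed.

Lemma near_sphere_family_level (q0 : V) :
  \forall q \near q0, sphere_family q -> q.2 = q0.2.
Proof.
have [e e0 level] := sphere_family_near_level q0.2.
near=> q => Fq; have /level[/(_ Fq)[_ []//]] : `|q.2 - q0.2| < e.
near: q; apply: open_nbhs_nbhs; split; first exact: open_slab.
by rewrite /= subrr normr0.
Unshelve. all: by end_near. Qed.

Lemma closed_sphere_family : closed sphere_family.
Proof.
move=> q0 clF; have near_level B : nbhs q0 B -> exists q, [/\ B q, D q0.2 &
    sphere_fibre (Q q0.2) (a q0.2) (rho q0.2) q0.2 q].
  move=> /(filterI (near_sphere_family_level q0))/clF[q [Fq [/(_ Fq) ql Bq]]].
  by exists q; move: Fq; rewrite sphere_familyP ql => -[].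
have [_ [_ Dq0 _]] := near_level _ filterT.
apply/sphere_familyP; split=> //; apply: closed_sphere_fibre => B /near_level.
by move=> [q [Bq _ fq]]; exists q.
Qed.

Lemma submanifold_sphere_family :
  (forall l, Q l *m Q l = Q l) -> (forall l, a l *m Q l = 0) ->
  (forall l, D l -> rho l != 0) -> submanifold sphere_family.
Proof.
move=> Q_idem aQ rho0.
apply: submanifold_slice_chart => q /sphere_familyP[Dq fq].
have [e e0 level] := sphere_family_near_level q.2.
apply: (slice_chart_local (@open_slab R m q.2 e)); last first.
- exact: slice_chart_sphere_fibre (Q_idem _) (aQ _) (rho0 _ Dq) fq.
- by move=> x /level ->; split=> [[]|].
- by rewrite /= subrr normr0.
Qed.

Lemma connected_component_sphere_family q q' :
  connected_component sphere_family q q' -> q.2 = q'.2.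
Proof.
move=> [C [Cq CF Cconn] Cq'].
apply: (@connected_locally_finite _ (snd @` C) _ _ _ levels_locally_finite).
- apply: connected_continuous_connected => //.
  by apply: continuous_subspaceT => x; exact: cvg_snd.
- exact: image_subset.
- by exists q.
- by exists q'.
Qed.

End SphereFamily.

Section OrthonormalBasis.
Context {R : realType} {m : nat}.
Implicit Types Q : 'M[R]_m.

Lemma projector_deflation Q (e : 'rV[R]_m) : Q^T = Q -> Q *m Q = Q ->
  e *m e^T = 1%:M -> e *m Q = e -> let Q' := Q - e^T *m e in
  [/\ Q'^T = Q', Q' *m Q' = Q', e *m Q' = 0 & (\rank Q' < \rank Q)%N].
Proof.
move=> Q_sym Q_idem e1 eQ Q'.
have Qe : Q *m e^T = e^T by rewrite -{1}Q_sym -trmx_mul eQ.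
have eQ' : e *m Q' = 0 by rewrite mulmxBr eQ mulmxA e1 mul1mx subrr.
have Q'_idem : Q' *m Q' = Q'.
  by rewrite {1}/Q' mulmxBl -mulmxA eQ' mulmx0 subr0 mulmxBr Q_idem mulmxA Qe.
split=> //; first by rewrite linearB /= trmx_mul trmxK Q_sym.
apply/rank_ltmx; rewrite ltmxE; apply/andP; split.
  by apply/submxP; exists Q'; rewrite mulmxBl Q_idem -mulmxA eQ.
apply/negP => QQ'; have /submxP[w ew] : (e <= Q')%MS.
  by apply: submx_trans QQ'; rewrite -eQ submxMl.
have e0 : e = 0 by rewrite ew -Q'_idem mulmxA -ew eQ'.
move: e1; rewrite e0 mul0mx.
by move=> /matrixP/(_ 0 0)/eqP; rewrite !mxE eq_sym oner_eq0.
Qed.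

Lemma orthonormal_basis Q : Q^T = Q -> Q *m Q = Q ->
  exists r (B : 'M[R]_(r, m)), B *m B^T = 1%:M /\ B^T *m B = Q.
Proof.
move: {2}(\rank Q).+1 (ltnSn (\rank Q)) => n.
elim: n Q => // n IH Q rank_Q Q_sym Q_idem.
have [->|/rowV0Pn[_ /submxP[w ->] v0]] := eqVneq Q 0.
  by exists 0, 0; split; [rewrite [LHS]flatmx0 [RHS]flatmx0|rewrite mulmx0].
set v := w *m Q in v0; pose e := (Num.sqrt (sqnorm v))^-1 *: v.
have e1 : e *m e^T = 1%:M.
  apply/matrixP => i j; rewrite !ord1 -/(dot e e) -sqnormE sqnormZ exprVn.
  by rewrite sqr_sqrtr ?sqnorm_ge0// mulVf ?sqnorm_eq0// mxE eqxx.
have eQ : e *m Q = e by rewrite /e -scalemxAl -mulmxA Q_idem.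
have [Q'_sym Q'_idem eQ' rank_Q'] := projector_deflation Q_sym Q_idem e1 eQ.
have [|r [B [B1 BQ]]] := IH _ _ Q'_sym Q'_idem.
  by rewrite -ltnS (leq_trans _ rank_Q).
have eB : e *m B^T = 0.
  by rewrite -[B^T]mulmx1 -B1 !mulmxA -(mulmxA e) BQ eQ' mul0mx.
exists (1 + r)%N, (col_mx e B); rewrite tr_col_mx mul_row_col BQ addrC subrK.
have Be : B *m e^T = 0 by rewrite -[B]trmxK -trmx_mul eB trmx0.
by split=> //; rewrite mul_col_row e1 B1 eB Be -scalar_mx_block.
Qed.

End OrthonormalBasis.

Lemma homeomorphic_sigT (X : topologicalType) (I : choiceType)
    (Y : I -> topologicalType) (idx : X -> I)
    (f : forall i, X -> Y i) (g : forall i, Y i -> X) :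
  (forall x, \forall y \near x, idx y = idx x) ->
  (forall x, {for x, continuous (f (idx x))}) -> (forall i, continuous (g i)) ->
  (forall i y, idx (g i y) = i) -> (forall x, g (idx x) (f (idx x) x) = x) ->
  (forall i y, f i (g i y) = y) ->
  homeomorphic X {i : I & Y i}.
Proof.
move=> idx_near cf cg idxg gf fg; pose F x := existT Y (idx x) (f (idx x) x).
have FE x i : idx x = i -> F x = existT Y i (f i x) by move=> <-.
exists F, (fun iy => g (projT1 iy) (projT2 iy)); split.
- move=> x; have near_F : {near x, existT Y (idx x) \o f (idx x) =1 F}.
    by apply: filterS (idx_near x) => y /FE ->.
  apply: (cvg_trans (near_eq_cvg near_F)).
  exact: (cvg_comp _ _ (cf x) (@existT_continuous _ Y _ _)).
- by move=> [i y] U nU; exact: (cg i y U nU).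
- by move=> x; rewrite /= gf.
- by move=> [i y]; rewrite (FE _ i) ?idxg//= fg.
Qed.

Lemma continuous_insubd (X T : topologicalType) (S : set T) (s0 : S)
    (h : X -> T) (x : X) :
  {for x, continuous h} -> (\forall y \near x, S (h y)) ->
  {for x, continuous (fun y => insubd s0 (h y) : S)}.
Proof.
move=> ch Sh U; rewrite nbhsE => -[W [[Z oZ <-] WZ] WU].
have hE y : S (h y) -> set_val (insubd s0 (h y)) = h y.
  by move=> Sy; apply: insubdK; exact: mem_set.
have Zx : Z (h x) by rewrite -(hE x) //; exact: nbhs_singleton Sh.
have nZ : nbhs x (h @^-1` Z) by apply: ch; exact: open_nbhs_nbhs.
apply: filterS (filterI nZ Sh) => y [Zy /hE yE]; apply: WU.
by rewrite /= yE.
Qed.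

Lemma union_of_spheres_coords (R : realType) (T : topologicalType) (F : set T)
    (J : choiceType) (idx : F -> J) (d : J -> nat)
    (f : forall i, T -> 'rV[R]_(d i).+1) (g : forall i, 'rV[R]_(d i).+1 -> T) :
  (forall q, \forall q' \near q, idx q' = idx q) ->
  (forall i, continuous (f i)) -> (forall i, continuous (g i)) ->
  (forall q, let y := f (idx q) (set_val q) in
    sphere R (d (idx q)) y /\ g (idx q) y = set_val q) ->
  (forall i y, sphere R (d i) y -> exists q : F,
    [/\ set_val q = g i y, idx q = i & f i (g i y) = y]) ->
  union_of_spheres R F.
Proof.
move=> idx_near cf cg fP gP; have valC (X : topologicalType) (S : set X) :
    continuous (set_val : S -> X) by exact: initial_continuous.
have gS i (y : sphere R (d i)) := gP i _ (set_mem (valP y)).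
pose G i y : F := sval (cid (gS i y)).
have GP i y : [/\ set_val (G i y) = g i (set_val y), idx (G i y) = i &
    f i (g i (set_val y)) = set_val y] := svalP (cid (gS i y)).
have pole_sphere i : sphere R (d i) (delta_mx 0 0).
  by rewrite /sphere /= sqnormE /dot trmx_delta mul_delta_mx mxE.
pose pole i : sphere R (d i) :=
  exist _ (delta_mx 0 0) (mem_set (pole_sphere i)).
pose f' i (q : F) : sphere R (d i) := insubd (pole i) (f i (set_val q)).
have f'E i q :
    sphere R (d i) (f i (set_val q)) -> set_val (f' i q) = f i (set_val q).
  by move=> fq; apply: insubdK; exact: mem_set.
exists J, d; apply: (homeomorphic_sigT (f := f') (g := G) idx_near).
- move=> q; apply: continuous_insubd.
    apply: (@continuous_comp _ _ _ (set_val : F -> T)); first exact: valC.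
    exact: cf.
  by apply: filterS (idx_near q) => q' <-; have [] := fP q'.
- move=> i; apply: continuous_comp_initial => y.
  have -> : set_val \o @G i = g i \o set_val.
    by apply/funext => y'; have [] := GP i y'.
  by apply: continuous_comp; [exact: valC|exact: cg].
- by move=> i y; have [] := GP i y.
- move=> q; have [fq gfq] := fP q; have [Gq _ _] := GP _ (f' (idx q) q).
  by apply: val_inj; rewrite [LHS]Gq f'E.
- move=> i y; have [Gy _ fg] := GP i y; apply: val_inj.
  by rewrite [LHS]f'E Gy fg//; exact: set_mem (valP y).
Qed.

Section SphereFibreCoordinates.
Context {R : realType} {m d : nat} (Q : 'M[R]_m) (a : 'rV[R]_m) (r l : R).
Context (B : 'M[R]_(d, m)) (B_orthonormal : B *m B^T = 1%:M).
Context (B_range : B^T *m B = Q) (aQ : a *m Q = 0) (r_gt0 : 0 < r).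
Local Notation V := (coords R m).

Definition fibre_coord (q : V) : 'rV[R]_d := (Num.sqrt r)^-1 *: (q.1 *m B^T).
Definition fibre_point (v : 'rV[R]_d) : V := (a + Num.sqrt r *: (v *m B), l).

Let sqrt_r_neq0 : Num.sqrt r != 0.
Proof. by rewrite gt_eqF// sqrtr_gt0. Qed.

Let aB : a *m B^T = 0.
Proof.
by rewrite -[B^T]mulmx1 -B_orthonormal !mulmxA -(mulmxA a) B_range aQ mul0mx.
Qed.

Lemma sqnorm_mul_orthonormal (v : 'rV[R]_d) : sqnorm (v *m B) = sqnorm v.
Proof.
by rewrite !sqnormE dot_mulmx -mulmxA B_orthonormal mulmx1.
Qed.

Lemma fibre_coordK q :
  sphere_fibre Q a r l q -> fibre_point (fibre_coord q) = q.
Proof.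
move=> [ql qa _]; rewrite /fibre_point -scalemxAl scalerA divff// scale1r.
by rewrite -mulmxA B_range -qa subrK -ql -surjective_pairing.
Qed.

Lemma fibre_pointK : cancel fibre_point fibre_coord.
Proof.
move=> v; rewrite /fibre_coord mulmxDl aB add0r -scalemxAl scalerA mulVf//.
by rewrite scale1r -mulmxA B_orthonormal mulmx1.
Qed.

Lemma sphere_fibre_coord q :
  sphere_fibre Q a r l q -> sqnorm (fibre_coord q) = 1.
Proof.
move=> [_ _ qr]; rewrite sqnormZ exprVn sqr_sqrtr ?ltW//.
have -> : sqnorm (q.1 *m B^T) = r.
  by rewrite -qr -B_range mulmxA sqnorm_mul_orthonormal.
by rewrite mulVf ?gt_eqF.
Qed.

Lemma sphere_fibre_point v :
  sqnorm v = 1 -> sphere_fibre Q a r l (fibre_point v).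
Proof.
move=> v1; have pQ : (fibre_point v).1 *m Q = Num.sqrt r *: (v *m B).
  rewrite mulmxDl aQ add0r -scalemxAl -mulmxA -B_range (mulmxA B) B_orthonormal.
  by rewrite mul1mx.
split=> //; rewrite pQ ?addrK// sqnormZ sqr_sqrtr ?ltW//.
by rewrite sqnorm_mul_orthonormal v1 mulr1.
Qed.

Lemma continuous_fibre_coord : continuous fibre_coord.
Proof.
move=> q; apply: (@continuous_comp _ _ _ (fun q : V => q.1 *m B^T)
  (fun u => (Num.sqrt r)^-1 *: u)).
  exact: continuous_fst_mulmx.
exact: scaler_continuous.
Qed.

Lemma continuous_fibre_point : continuous fibre_point.
Proof.
move=> v; have ca : {for v, continuous (fun _ : 'rV[R]_d => a)}.
  exact: cst_continuous.
have cB : {for v, continuous (fun v : 'rV[R]_d => Num.sqrt r *: (v *m B))}.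
  apply: (@continuous_comp _ _ _ (fun v : 'rV[R]_d => v *m B)
    (fun w => Num.sqrt r *: w)).
    exact: continuous_mulmxr.
  exact: scaler_continuous.
have cl : {for v, continuous (fun _ : 'rV[R]_d => l : R^o)}.
  exact: cst_continuous.
exact: cvg_pair (cvgD ca cB) cl.
Qed.

End SphereFibreCoordinates.

Section SphereFamilyComponents.
Context {R : realType} {m : nat}.
Context (Q : R -> 'M[R]_m) (a : R -> 'rV[R]_m) (rho : R -> R) (D : set R).
Context (Q_sym : forall l, (Q l)^T = Q l) (Q_idem : forall l, Q l *m Q l = Q l).
Context (aQ : forall l, a l *m Q l = 0).
Context (rho_neq0 : forall l, D l -> rho l != 0).
Local Notation V := (coords R m).
Local Notation F := (sphere_family Q a rho D).
Context (levels_locally_finite : locally_finite (snd @` F)).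

Lemma sphere_family_level_basis l : (snd @` F) l ->
  exists d (B : 'M[R]_(d.+1, m)),
    [/\ D l, 0 < rho l, B *m B^T = 1%:M & B^T *m B = Q l].
Proof.
move=> [q /sphere_familyP[Dq [_ _ qr]] <-].
have rho_gt0 : 0 < rho q.2.
  by rewrite lt_neqAle eq_sym rho_neq0//= -qr sqnorm_ge0.
have [[|d] [B [B1 BQ]]] := orthonormal_basis (Q_sym q.2) (Q_idem q.2).
  by move: rho_gt0; rewrite -qr -BQ [B]flatmx0 !mulmx0 sqnorm0 ltxx.
by exists d, B.
Qed.

Lemma union_of_spheres_sphere_family : union_of_spheres R F.
Proof.
pose J : set R := snd @` F; pose lvl (i : J) : R := set_val i.
have [d dP] :=
  choice (fun i : J => sphere_family_level_basis (set_mem (valP i))).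
pose B i := sval (cid (dP i)).
have BP i : [/\ D (lvl i), 0 < rho (lvl i), B i *m (B i)^T = 1%:M &
    (B i)^T *m B i = Q (lvl i)] := svalP (cid (dP i)).
have F_level (q : F) : J (set_val q).2.
  by exists (set_val q) => //; exact: set_mem (valP q).
pose idx (q : F) : J := exist _ (set_val q).2 (mem_set (F_level q)).
apply: (union_of_spheres_coords (idx := idx) (d := d)
  (f := fun i => fibre_coord (rho (lvl i)) (B i))
  (g := fun i => fibre_point (a (lvl i)) (rho (lvl i)) (lvl i) (B i))).
- move=> q; have near_level :=
    near_sphere_family_level levels_locally_finite (set_val q).
  have : nbhs q (set_val @^-1` [set x | F x -> x.2 = (set_val q).2]).
    exact: initial_continuous near_level.
  apply: filterS => q' level; apply: val_inj; apply: level.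
  exact: set_mem (valP q').
- by move=> i; exact: continuous_fibre_coord.
- by move=> i; exact: continuous_fibre_point.
- move=> q /=; have [_ rho0 B1 BQ] := BP (idx q).
  have /sphere_familyP[_ fq] := set_mem (valP q).
  have sphere_q := sphere_fibre_coord B1 BQ rho0 fq.
  have coordK_q := fibre_coordK BQ rho0 fq.
  by split; [exact: sphere_q|exact: coordK_q].
- move=> i y Sy; have [Di rho0 B1 BQ] := BP i.
  have Fy : F (fibre_point (a (lvl i)) (rho (lvl i)) (lvl i) (B i) y).
    exists (lvl i) => //.
    have fy := sphere_fibre_point (lvl i) B1 BQ (aQ _) rho0 Sy.
    exact: fy.
  exists (exist _ (fibre_point _ _ _ (B i) y) (mem_set Fy)).
  split=> //; first exact: val_inj.
  exact: fibre_pointK _ B1 BQ (aQ _) rho0 y.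
Qed.

End SphereFamilyComponents.

(** * The fibres of the exponential map *)

Section FibresOfExp.
Context {R : realType} {m : nat} {I : finType} (A : 'M[R]_m).
Context (alpha : I -> R) (P : I -> 'M[R]_m) (AP : skew_resolution A alpha P).
Context (x : 'rV[R]_m) (z : R).
Implicit Types (l : R) (j : I) (u : 'rV[R]_m).

Local Notation d_re l j := (displacement_re alpha l j 1).
Local Notation d_im l j := (displacement_im alpha l j 1).

(* The squared modulus of the complex number displacement 1 on the range of
   P j. *)
Definition modulus l j : R := d_re l j ^+ 2 + alpha j ^+ 2 * d_im l j ^+ 2.

Definition resonant_projector l : 'M[R]_m := \sum_(j | modulus l j == 0) P j.

(* Division by a zero modulus gives 0: this is the inverse of displacement 1 off
   the resonant subspace and 0 on it. *)
Definition displacement_pinv l : 'M[R]_m :=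
  skew_mx A P (fun j => d_re l j / modulus l j)
    (fun j => - d_im l j / modulus l j).

Definition compatible : set R := [set l | x *m resonant_projector l = 0].

Definition fixed_part l : 'rV[R]_m := x *m displacement_pinv l.

Definition area l j : R :=
  2^-1 * (alpha j * ((l * alpha j - sin (l * alpha j)) / (l * alpha j) ^+ 2)).

Definition radius2 l : R := if l == 0 then z else
  2 * l * (z - \sum_j area l j * sqnorm (fixed_part l *m P j)).

Local Notation disp l := (displacement A alpha P l 1).
Local Notation Q := resonant_projector.

Lemma modulusE l j : l != 0 ->
  modulus l j = 2 * (1 - cos (l * alpha j)) / (l * alpha j) ^+ 2.
Proof.
move=> l0.
rewrite /modulus /displacement_re /displacement_im (negbTE l0) !mulr1.
by field: (sin2cos2 (l * alpha j)); rewrite l0 gt_eqF// (resolution_gt0 AP).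
Qed.

Lemma modulus_eq0 l j : modulus l j = 0 <-> l != 0 /\ cos (l * alpha j) = 1.
Proof.
have [->|l0] := eqVneq l 0.
  rewrite /modulus /displacement_re /displacement_im eqxx !mul0r cos0 subrr.
  rewrite mul0r expr1n expr0n mulr0 addr0.
  by split=> [/eqP|[]//]; rewrite oner_eq0.
rewrite modulusE//; split=> [/eqP|[_ ->]]; last by rewrite subrr mulr0 mul0r.
rewrite mulf_eq0 invr_eq0 sqrf_eq0 [l * _ == 0]mulf_eq0 (negbTE l0).
rewrite [alpha j == 0]gt_eqF ?(resolution_gt0 AP)// mulf_eq0 pnatr_eq0 /= !orbF.
by rewrite subr_eq0 => /eqP <-.
Qed.

Lemma resonant_displacement l j :
  modulus l j = 0 -> d_re l j = 0 /\ d_im l j = 0.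
Proof.
rewrite /modulus => /eqP; rewrite -exprMn paddr_eq0 ?sqr_ge0// !sqrf_eq0.
rewrite mulf_eq0 [alpha j == 0]gt_eqF ?(resolution_gt0 AP)//.
by move=> /andP[/eqP -> /eqP ->].
Qed.

Lemma resonant_projectorE l :
  Q l = skew_mx A P (fun j => (modulus l j == 0)%:R) (fun=> 0).
Proof. exact: sum_proj. Qed.

Lemma nonresonant_projectorE l :
  1%:M - Q l = skew_mx A P (fun j => (modulus l j != 0)%:R) (fun=> 0).
Proof.
rewrite -sum_proj -(resolution_sum AP) (bigID (fun j => modulus l j == 0)) /=.
by rewrite addrAC subrr add0r.
Qed.

Lemma resonant_projector_sym l : (Q l)^T = Q l.
Proof.
rewrite resonant_projectorE (tr_skew_mx AP).
by apply: eq_skew_mx => j; rewrite ?oppr0.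
Qed.

Lemma resonant_projector_idem l : Q l *m Q l = Q l.
Proof.
rewrite resonant_projectorE (skew_mxM AP); apply: eq_skew_mx => j.
  by case: eqP => _; rewrite !mul0r mulr0 subr0 ?mulr1 ?mulr0.
by rewrite mul0r mulr0 addr0.
Qed.

Lemma resonant_projector_mulP l j : modulus l j = 0 -> Q l *m P j = P j.
Proof.
move=> mj; rewrite mulmx_suml (bigD1 j)/= ?mj// (resolution_mul AP) eqxx.
rewrite big1 ?addr0// => i /andP[_ ij].
by rewrite (resolution_mul AP) (negbTE ij).
Qed.

Lemma compatible_resonant l j : compatible l -> modulus l j = 0 -> x *m P j = 0.
Proof.
by move=> Dl mj; rewrite -(resonant_projector_mulP mj) mulmxA Dl mul0mx.
Qed.

Lemma skew_mx_mul_resonant l (a b : I -> R) :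
  (forall j, modulus l j = 0 -> a j = 0 /\ b j = 0) ->
  skew_mx A P a b *m Q l = 0.
Proof.
move=> ab0; rewrite resonant_projectorE (skew_mxM AP); apply: big1 => j _.
have [/ab0[-> ->]|_] := eqVneq (modulus l j) 0;
  by rewrite !(mul0r, mulr0, subr0, addr0, scale0r).
Qed.

Lemma displacement_resonant l : disp l *m Q l = 0.
Proof. exact/skew_mx_mul_resonant/resonant_displacement. Qed.

Lemma displacement_pinv_resonant l : displacement_pinv l *m Q l = 0.
Proof. by apply: skew_mx_mul_resonant => j ->; rewrite invr0 !mulr0. Qed.

Lemma displacement_mul_pinv l : disp l *m displacement_pinv l = 1%:M - Q l.
Proof.
rewrite nonresonant_projectorE (skew_mxM AP).
apply: eq_skew_mx => j /=; last by ring.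
have [m0|m0] := eqVneq (modulus l j) 0; first by rewrite m0 invr0 /=; ring.
rewrite -[RHS](divff m0) {3}/modulus; ring.
Qed.

Lemma displacement_eq l u : u *m disp l = x <->
  compatible l /\ u - u *m Q l = fixed_part l.
Proof.
have comm_pinv : displacement_pinv l *m disp l = 1%:M - Q l.
  by rewrite -displacement_mul_pinv; exact: (skew_mxC AP).
have comm_Q : Q l *m disp l = 0.
  rewrite -(displacement_resonant l) resonant_projectorE.
  exact: (skew_mxC AP).
rewrite /compatible /fixed_part /=; split=> [<-|[xQ uQ]].
  rewrite -mulmxA displacement_resonant mulmx0 -mulmxA displacement_mul_pinv.
  by rewrite mulmxBr mulmx1.
rewrite -[u](subrK (u *m Q l)) uQ mulmxDl -!mulmxA comm_pinv comm_Q.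
by rewrite mulmx0 addr0 mulmxBr mulmx1 xQ subr0.
Qed.

Lemma fixed_part_resonant l : fixed_part l *m Q l = 0.
Proof. by rewrite /fixed_part -mulmxA displacement_pinv_resonant mulmx0. Qed.

Lemma sqnorm_resonant l u :
  sqnorm (u *m Q l) = \sum_j (modulus l j == 0)%:R * sqnorm (u *m P j).
Proof.
rewrite resonant_projectorE (sqnorm_skew_mx AP); apply: eq_bigr => j _.
by rewrite expr0n mulr0 addr0; case: eqP => _; rewrite ?expr1n ?expr0n.
Qed.

Lemma sqnorm_nonresonant_proj l u j :
  sqnorm ((u - u *m Q l) *m P j) = (modulus l j != 0)%:R * sqnorm (u *m P j).
Proof.
rewrite -[X in X - _]mulmx1 -mulmxBr nonresonant_projectorE.
rewrite (sqnorm_skew_mx_mulP AP) expr0n mulr0 addr0.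
by case: eqP => _; rewrite ?expr1n ?expr0n.
Qed.

Lemma sqnorm_fixed_part_proj l j :
  sqnorm (fixed_part l *m P j) = sqnorm (x *m P j) / modulus l j.
Proof.
rewrite (sqnorm_skew_mx_mulP AP) mulrC; congr (_ * _).
have [m0|m0] := eqVneq (modulus l j) 0; first by rewrite m0 invr0; ring.
transitivity (modulus l j / modulus l j ^+ 2); last by field.
by rewrite {3}/modulus; field.
Qed.

Lemma heightE l u :
  height alpha P u l 1 = \sum_j area l j * sqnorm (u *m P j).
Proof.
rewrite /height mulr_sumr; apply: eq_bigr => j _.
by rewrite /area !mulr1; ring.
Qed.

Lemma area_resonant l j : modulus l j = 0 -> 2 * l * area l j = 1.
Proof.
move=> /modulus_eq0[l0 /cos_eq1_sin0 s0]; rewrite /area s0.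
by field; rewrite l0 gt_eqF ?(resolution_gt0 AP).
Qed.

Lemma height_sub_fixed_part l u : u - u *m Q l = fixed_part l ->
  2 * l * (height alpha P u l 1 -
    \sum_j area l j * sqnorm (fixed_part l *m P j)) = sqnorm (u *m Q l).
Proof.
move=> <-; rewrite heightE sqnorm_resonant -sumrB mulr_sumr.
apply: eq_bigr => j _; rewrite sqnorm_nonresonant_proj.
have [/area_resonant mj|_] := eqVneq (modulus l j) 0.
  by rewrite -mulrBr mul0r subr0 mulrA mj.
by rewrite mul1r subrr mulr0 mul0r.
Qed.

Lemma height_radius2 l u : u - u *m Q l = fixed_part l ->
  height alpha P u l 1 = z <-> sqnorm (u *m Q l) = radius2 l.
Proof.
move=> uQ; rewrite -(height_sub_fixed_part uQ) /radius2.
case: eqVneq => [->|l0].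
  rewrite mulr0 mul0r heightE big1// => j _.
  by rewrite /area mul0r sin0 subrr mul0r !mulr0 mul0r.
split=> [-> //|/mulfI eq_z].
apply: (addIr (- \sum_j area l j * sqnorm (fixed_part l *m P j))).
by apply: eq_z; rewrite mulf_neq0 ?pnatr_eq0.
Qed.

Local Notation family := (sphere_family Q fixed_part radius2).

Lemma Gamma_sphere_family : Gamma A (x, z) = family compatible.
Proof.
apply/seteqP; split=> -[u l]; rewrite /Gamma /= (exp_mapE AP).
  move=> uE; have /displacement_eq[Dl uQ] := congr1 fst uE.
  apply/sphere_familyP; split=> //; split=> //=.
  by apply/height_radius2; case: uE.
move=> /sphere_familyP[/= Dl [_ /= uQ ur]].
by apply: (congr2 pair); [exact/displacement_eq|exact/(height_radius2 uQ)].
Qed.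

Lemma sum_proj_sqnorm_family u l : family compatible (u, l) ->
  \sum_(j | x *m P j == 0) sqnorm (u *m P j) = radius2 l.
Proof.
move=> /sphere_familyP[/= Dl [_ /= uQ <-]]; rewrite sqnorm_resonant big_mkcond.
apply: eq_bigr => j _; have := sqnorm_nonresonant_proj l u j.
rewrite uQ sqnorm_fixed_part_proj; have [mj _|mj] := eqVneq (modulus l j) 0.
  by rewrite (compatible_resonant Dl mj) eqxx mul1r.
by rewrite mul1r mul0r; case: eqP => // -> <-; rewrite sqnorm0 mul0r.
Qed.

Lemma energy_family u l : family compatible (u, l) ->
  energy (geodesic A (u, l)) = 2^-1 * (sqnorm (fixed_part l) + radius2 l).
Proof.
move=> /sphere_familyP[/= _ [_ /= uQ <-]]; rewrite (energyE AP).
rewrite -[u in LHS](subrK (u *m Q l)) uQ sqnormD dotC dot_mulmx.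
by rewrite resonant_projector_sym fixed_part_resonant dot0r mulr0 addr0.
Qed.

Let weight j : R := alpha j / 4 * sqnorm (x *m P j).

Lemma sum_area_slope l : l != 0 ->
  \sum_j area l j * sqnorm (fixed_part l *m P j) =
  dilation_sum alpha weight slope l.
Proof.
move=> l0; apply: eq_bigr => j _; rewrite sqnorm_fixed_part_proj modulusE//.
rewrite /area /slope /weight; have [c1|c1] := eqVneq (cos (l * alpha j)) 1.
  by rewrite c1 subrr mulr0 mul0r invr0 !mulr0.
have c1' : 1 - cos (l * alpha j) != 0 by rewrite subr_eq0 eq_sym.
by field; rewrite ?c1' ?l0 ?gt_eqF// (resolution_gt0 AP).
Qed.

Lemma weight_neq0 j : (weight j != 0) = (x *m P j != 0).
Proof.
rewrite !mulf_eq0 invr_eq0 pnatr_eq0 sqnorm_eq0.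
by rewrite [alpha j == 0]gt_eqF ?(resolution_gt0 AP).
Qed.

Lemma compatible_admissible l :
  l != 0 -> compatible l -> admissible alpha weight l.
Proof.
move=> l0 Dl j; rewrite weight_neq0; apply: contra_neq => c1.
by apply: (compatible_resonant Dl); apply/modulus_eq0.
Qed.

Hypothesis xz_neq0 : (x, z) <> 0.

Lemma finite_zero_radius2 : finite_set (compatible `&` [set l | radius2 l = 0]).
Proof.
have slope_z l :
    l != 0 -> radius2 l = 0 -> dilation_sum alpha weight slope l = z.
  move=> l0 /eqP; rewrite /radius2 (negbTE l0) sum_area_slope// !mulf_eq0.
  by rewrite pnatr_eq0 (negbTE l0) subr_eq0 => /eqP.
have [x0|x0] := eqVneq x 0.
  rewrite (_ : _ `&` _ = set0); first exact: finite_set0.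
  apply/seteqP; split=> // l [_ /= rl]; apply: xz_neq0; rewrite x0.
  have [l0|l0] := eqVneq l 0; first by move: rl; rewrite /radius2 l0 eqxx => ->.
  rewrite -(slope_z l l0 rl) /dilation_sum big1// => j _.
  by rewrite /weight x0 mul0mx sqnorm0 mulr0 mul0r.
have weight_ge0 j : 0 <= weight j.
  by rewrite !mulr_ge0 ?sqnorm_ge0// ltW// (resolution_gt0 AP).
have weight_ex : exists j, weight j != 0.
  apply: contrapT => weight0; case/eqP: x0.
  rewrite -[x]mulmx1 -(resolution_sum AP) mulmx_sumr big1// => j _.
  by apply/eqP/negPn/negP; rewrite -weight_neq0 => wj; apply: weight0; exists j.
have finS := finite_slope_level (resolution_gt0 AP) weight_ge0 weight_ex z.
have fin0S := conj (finite_set1 (0 : R)) finS.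
rewrite -finite_setU in fin0S; apply: sub_finite_set fin0S.
move=> l [Dl rl]; have [->|l0] := eqVneq l 0; [by left|right].
by split=> //; [exact: compatible_admissible|exact: slope_z].
Qed.

Lemma locally_finite_levels D :
  D `<=` compatible -> locally_finite (snd @` family D).
Proof.
move=> Dcompat; apply: sub_locally_finite
  (locally_finiteU (finite_locally_finite finite_zero_radius2)
     (locally_finite_resonances (resolution_gt0 AP))) => _ [q + <-].
move=> /sphere_familyP[/Dcompat Dq [_ _ qr]].
have [r0|r0] := eqVneq (radius2 q.2) 0; [by left|right].
apply: contrapT => no_res; case/eqP: r0; rewrite -qr /resonant_projector.
rewrite big_pred0 ?mulmx0 ?sqnorm0// => j; apply/negP => /eqP/modulus_eq0[_ c1].
by apply: no_res; exists j.
Qed.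

Lemma energy_connected_component q q' :
  Gamma A (x, z) q -> connected_component (Gamma A (x, z)) q q' ->
  energy (geodesic A q) = energy (geodesic A q').
Proof.
rewrite Gamma_sphere_family; case: q => u l; case: q' => u' l' Fu Cu.
have levels := locally_finite_levels (@subset_refl _ compatible).
have /= ll' := connected_component_sphere_family levels Cu.
by rewrite (energy_family Fu) (energy_family (connected_component_sub Cu)) ll'.
Qed.

End FibresOfExp.

Lemma Gamma0_Gammaoo_partition (R : realType) (m k : nat) (A : 'M[R]_m)
    (alpha : 'I_k -> R) (p : coords R m) :
  Gamma A p = Gamma0 A alpha p `|` Gammaoo A alpha p /\
  Gamma0 A alpha p `&` Gammaoo A alpha p = set0.
Proof.
rewrite /Gammaoo; split; last by rewrite setDE setICA setICr setI0.
by rewrite setDUK// => eta [].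
Qed.

Section SingularValueFamilies.
Context {R : realType} {m k : nat} (A : 'M[R]_m) (alpha : 'I_k -> R).
Let P : 'I_k -> 'M[R]_m := sv_projector A \o alpha.
Context (AP : skew_resolution A alpha P) (x : 'rV[R]_m) (z : R).
Local Notation family :=
  (sphere_family (resonant_projector alpha P) (fixed_part A alpha P x)
    (radius2 A alpha P x z)).
Local Notation D := (compatible alpha P x).
Local Notation rho := (radius2 A alpha P x z).

Lemma Gamma0_sphere_family :
  Gamma0 A alpha (x, z) = family (D `&` [set l | rho l = 0]).
Proof.
rewrite /Gamma0 (Gamma_sphere_family AP); apply/seteqP; split=> -[u l].
  move=> [Fu]; rewrite [X in X = 0](sum_proj_sqnorm_family AP Fu) => r0.
  by have [l' Dl' fl'] := Fu; exists l' => //; split=> //; have [<-] := fl'.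
move=> [l' [Dl' r0] fl']; have Fu : family D (u, l) by exists l'.
split=> //; rewrite [LHS](sum_proj_sqnorm_family AP Fu).
by have [/= -> _ _] := fl'.
Qed.

Lemma Gammaoo_sphere_family :
  Gammaoo A alpha (x, z) = family (D `&` [set l | rho l != 0]).
Proof.
rewrite /Gammaoo Gamma0_sphere_family (Gamma_sphere_family AP).
apply/seteqP; split=> q.
  move=> [/sphere_familyP[Dq fq] nF].
  apply/sphere_familyP; split=> //; split=> //.
  by apply/eqP => r0; apply: nF; apply/sphere_familyP.
move=> /sphere_familyP[[Dq r0] fq]; split; first exact/sphere_familyP.
by move=> /sphere_familyP[[_ r0'] _]; rewrite /= r0' eqxx in r0.
Qed.

End SingularValueFamilies.

Theorem theorem4 (R : realType) (n : nat) (n_gt0 : (0 < n)%N)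
    (A : 'M[R]_(2 * n)) (A_skew : A^T = - A) (A_nondeg : A \in unitmx)
    (k : nat) (alpha : 'I_k -> R)
    (alpha_incr : forall i j : 'I_k, (i < j)%N -> alpha i < alpha j)
    (alpha_sv : forall a : R, singular_value A a <-> exists j, alpha j = a)
    (p : coords R (2 * n)) (p_neq0 : p <> 0) :
  [/\ Gamma A p = Gamma0 A alpha p `|` Gammaoo A alpha p /\
      Gamma0 A alpha p `&` Gammaoo A alpha p = set0,
      (closed (Gamma0 A alpha p) /\ submanifold (Gamma0 A alpha p)) /\
      (closed (Gammaoo A alpha p) /\ submanifold (Gammaoo A alpha p)),
      finite_set (Gamma0 A alpha p),
      union_of_spheres R (Gammaoo A alpha p) &
      forall eta eta' : coords R (2 * n), Gamma A p eta ->
        connected_component (Gamma A p) eta eta' ->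
        energy (geodesic A eta) = energy (geodesic A eta')].
Proof.
have alpha_inj : injective alpha.
  by apply/inc_inj/le_mono => i j; exact: alpha_incr.
have AP := singular_value_resolution A_skew A_nondeg alpha_inj alpha_sv.
case: p p_neq0 => x z xz_neq0.
have finGamma0 : finite_set (Gamma0 A alpha (x, z)).
  rewrite (Gamma0_sphere_family AP); apply: finite_sphere_family => [|l []//].
  exact: finite_zero_radius2.
have Q_idem := resonant_projector_idem AP.
have fixedQ := fixed_part_resonant AP x.
have levels_oo := locally_finite_levels AP xz_neq0 (@subIsetl _ _ _).
split.
- exact: Gamma0_Gammaoo_partition.
- split; first by split; [exact: finite_set_closed|exact: finite_submanifold].
  rewrite (Gammaoo_sphere_family AP); split; first exact: closed_sphere_family.
  by apply: submanifold_sphere_family => // l [].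
- exact: finGamma0.
- rewrite (Gammaoo_sphere_family AP).
  apply: union_of_spheres_sphere_family => // [|l []//].
  exact: resonant_projector_sym AP.
by move=> eta eta'; exact: (energy_connected_component AP xz_neq0).
Qed.
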